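(* Let $d\ge2$ be a fixed integer. There exists an algorithm which, given any dataset $\mathcal{D}=\{(\bm{x}_i,y_i): i\in\{1,\dots,n\}\}$ with $\bm{x}_i\in\mathbb{R}^d$ and $y_i\in\{\pm1\}$ that is not linearly separable and has $n_+\ge1$ positive samples $\bm{x}_1^+,\dots,\bm{x}_{n_+}^+$ and $n_-\ge1$ negative samples $\bm{x}_1^-,\dots,\bm{x}_{n_-}^-$, solves exactly the linear AUC optimization problem, i.e. outputs a vector $$\bm{w}^\star\in\operatorname*{arg\,max}_{\bm{w}\in\mathbb{R}^d}\ \sum_{i=1}^{n_+}\sum_{j=1}^{n_-}\frac{\mathbf{1}\left[\bm{w}^\top\bm{x}_i^+>\bm{w}^\top\bm{x}_j^-\right]}{n_+n_-},$$ in time $\mathcal{O}\left((n_+n_-)^{d-1}\log(n_+n_-)\right)$.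
   Context: The indicator $\mathbf{1}[A]$ equals $1$ if $A$ is true and $0$ otherwise. Positive samples are the $\bm{x}_i$ with $y_i=1$ and negative samples are those with $y_i=-1$, so $n=n_++n_-$. The dataset is called linearly separable if there exists $\bm{w}$ with $\langle\bm{w},\bm{x}_i^+\rangle\ge0$ for all $i$ and $\langle\bm{w},\bm{x}_j^-\rangle<0$ for all $j$ (no bias/intercept term). Running time counts arithmetic operations (including square roots) and comparisons on real numbers at unit cost; $\mathcal{O}(\cdot)$ is asymptotic as $n_+n_-\to\infty$, with a constant that may depend on the fixed dimension $d$. *)

(* Defs.v *)
From HB Require Import structures.
From mathcomp Require Import all_boot all_order all_algebra.
From mathcomp Require Import reals exp.

Set Implicit Arguments.
Unset Strict Implicit.
Unset Printing Implicit Defensive.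

Import Order.TTheory GRing.Theory Num.Theory.
Local Open Scope ring_scope.

(* A uniform real RAM, presented as a structured while-language.  Programs are
   finite syntax trees that do not mention the field of reals; they manipulate
   two sorts of data, natural numbers (used for control and for addressing) and
   real numbers, each sort having scalar variables and unbounded arrays.
   Variables and arrays are named by literals, so a program uses finitely many
   of them, while array cells are addressed by computed indices.

   To keep the model as weak as the usual real RAM, there is no conversion from
   reals to integers (no floor), no integer multiplication, and the only real
   literals are natural numbers. *)

Inductive iexp : Type :=
| IVar of nat
| ILit of nat
| IGet of nat & iexp
| IAdd of iexp & iexp
| ISub of iexp & iexp.

Inductive rexp : Type :=
| RVar of nat
| RLit of nat
| RGet of nat & iexp
| RAdd of rexp & rexp
| RSub of rexp & rexp
| RMul of rexp & rexp
| RDiv of rexp & rexp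
| RSqrt of rexp.

Inductive bexp : Type :=
| BILe of iexp & iexp
| BRLe of rexp & rexp
| BNot of bexp
| BAnd of bexp & bexp.

Inductive cmd : Type :=
| Skip
| ISet of nat & iexp
| RSet of nat & rexp
| IPut of nat & iexp & iexp
| RPut of nat & iexp & rexp
| Seq of cmd & cmd
| If of bexp & cmd & cmd
| While of bexp & cmd.

Record state (R : realType) : Type := State {
  ivar : nat -> nat;
  rvar : nat -> R;
  iarr : nat -> nat -> nat;
  rarr : nat -> nat -> R
}.

Definition upd (T : Type) (f : nat -> T) (a : nat) (v : T) : nat -> T :=
  fun b => if b == a then v else f b.

Definition upd2 (T : Type) (f : nat -> nat -> T) (a j : nat) (v : T) :
    nat -> nat -> T :=
  upd f a (upd (f a) j v).

Fixpoint ieval (R : realType) (s : state R) (e : iexp) : nat :=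
  match e with
  | IVar a => ivar s a
  | ILit k => k
  | IGet a e1 => iarr s a (ieval s e1)
  | IAdd e1 e2 => (ieval s e1 + ieval s e2)%N
  | ISub e1 e2 => (ieval s e1 - ieval s e2)%N
  end.

(* Operations are total: division by 0 and the square root of a negative number
   return 0. *)
Fixpoint reval (R : realType) (s : state R) (e : rexp) : R :=
  match e with
  | RVar a => rvar s a
  | RLit k => k%:R
  | RGet a e1 => rarr s a (ieval s e1)
  | RAdd e1 e2 => reval s e1 + reval s e2
  | RSub e1 e2 => reval s e1 - reval s e2
  | RMul e1 e2 => reval s e1 * reval s e2
  | RDiv e1 e2 => reval s e1 / reval s e2
  | RSqrt e1 => Num.sqrt (reval s e1)
  end.

Fixpoint beval (R : realType) (s : state R) (b : bexp) : bool :=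
  match b with
  | BILe e1 e2 => (ieval s e1 <= ieval s e2)%N
  | BRLe e1 e2 => reval s e1 <= reval s e2
  | BNot b1 => ~~ beval s b1
  | BAnd b1 b2 => beval s b1 && beval s b2
  end.

(* Every literal, variable access, memory access, operation and comparison is
   charged one unit. *)
Fixpoint icost (e : iexp) : nat :=
  match e with
  | IVar _ | ILit _ => 1
  | IGet _ e1 => (icost e1).+1
  | IAdd e1 e2 | ISub e1 e2 => (icost e1 + icost e2).+1
  end.

Fixpoint rcost (e : rexp) : nat :=
  match e with
  | RVar _ | RLit _ => 1
  | RGet _ e1 => (icost e1).+1
  | RAdd e1 e2 | RSub e1 e2 | RMul e1 e2 | RDiv e1 e2 =>
      (rcost e1 + rcost e2).+1
  | RSqrt e1 => (rcost e1).+1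
  end.

Fixpoint bcost (b : bexp) : nat :=
  match b with
  | BILe e1 e2 => (icost e1 + icost e2).+1
  | BRLe e1 e2 => (rcost e1 + rcost e2).+1
  | BNot b1 => (bcost b1).+1
  | BAnd b1 b2 => (bcost b1 + bcost b2).+1
  end.

(* [exec c s t s']: started in state [s], the program [c] halts in state [s']
   after exactly [t] units of time. *)
Inductive exec (R : realType) : cmd -> state R -> nat -> state R -> Prop :=
| exec_skip s :
    exec Skip s 1 s
| exec_iset s a e :
    exec (ISet a e) s (icost e).+1
      (State (upd (ivar s) a (ieval s e)) (rvar s) (iarr s) (rarr s))
| exec_rset s a e :
    exec (RSet a e) s (rcost e).+1
      (State (ivar s) (upd (rvar s) a (reval s e)) (iarr s) (rarr s))
| exec_iput s a e1 e2 :
    exec (IPut a e1 e2) s (icost e1 + icost e2).+1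
      (State (ivar s) (rvar s)
         (upd2 (iarr s) a (ieval s e1) (ieval s e2)) (rarr s))
| exec_rput s a e1 e2 :
    exec (RPut a e1 e2) s (icost e1 + rcost e2).+1
      (State (ivar s) (rvar s) (iarr s)
         (upd2 (rarr s) a (ieval s e1) (reval s e2)))
| exec_seq c1 c2 s s1 s2 t1 t2 :
    exec c1 s t1 s1 -> exec c2 s1 t2 s2 -> exec (Seq c1 c2) s (t1 + t2) s2
| exec_if b c1 c2 s s' t :
    exec (if beval s b then c1 else c2) s t s' ->
    exec (If b c1 c2) s (bcost b + t).+1 s'
| exec_while_false b c s :
    ~~ beval s b -> exec (While b c) s (bcost b).+1 s
| exec_while_true b c s s1 s2 t1 t2 :
    beval s b -> exec c s t1 s1 -> exec (While b c) s1 t2 s2 ->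
    exec (While b c) s (bcost b + t1 + t2).+1 s2.

Lemma exec_det (R : realType) (c : cmd) (s : state R) t1 s1 t2 s2 :
  exec c s t1 s1 -> exec c s t2 s2 -> t1 = t2 /\ s1 = s2.
Proof.
move=> H; elim: H t2 s2 => {c s t1 s1} [s|s a e|s a e|s a e1 e2|s a e1 e2|
  c1 c2 s s1 s2 t1 t2 _ IH1 _ IH2|b c1 c2 s s' t _ IH|b c s Hb|
  b c s s1 s2 t1 t2 Hb _ IH1 _ IH2] t' s'' H;
  inversion H; subst=> //;
  repeat match goal with
  | H1 : is_true ?b, H2 : is_true (~~ ?b) |- _ => by rewrite H1 in H2
  | IH : (forall _ _, exec ?c ?s _ _ -> _), E : exec ?c ?s _ _ |- _ =>
      case: (IH _ _ E) => ? ?; clear E; subst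
  end; by [].
Qed.

(* Initial memory for the dataset (x_i, y_i), i < n: integer variable 0 holds n,
   real array 0 holds the points in row-major order, real array 1 holds the
   labels, and everything else is 0. *)
Definition input (R : realType) (d n : nat)
    (x : 'I_n -> 'cV[R]_d) (y : 'I_n -> R) : state R :=
  State
    (upd (fun=> 0%N) 0%N n)
    (fun=> 0)
    (fun _ _ => 0%N)
    (fun a j => match a with
      | 0 => match insub (j %/ d)%N, insub (j %% d)%N with
             | Some i, Some k => x i k 0
             | _, _ => 0
             end
      | 1 => if insub j is Some i then y i else 0
      | _ => 0
      end).

Lemma input_point (R : realType) (d n : nat)
    (x : 'I_n -> 'cV[R]_d) (y : 'I_n -> R) (i : 'I_n) (k : 'I_d) :
  rarr (input x y) 0 (i * d + k) = x i k 0.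
Proof.
have d0 : (0 < d)%N by apply: leq_ltn_trans (ltn_ord k).
rewrite /= divnMDl // divn_small // addn0 modnMDl modn_small //.
by rewrite !valK.
Qed.

Lemma input_label (R : realType) (d n : nat)
    (x : 'I_n -> 'cV[R]_d) (y : 'I_n -> R) (i : 'I_n) :
  rarr (input x y) 1 i = y i.
Proof. by rewrite /= valK. Qed.

(* The answer is read in the first d cells of real array 2. *)
Definition output (R : realType) (d : nat) (s : state R) : 'cV[R]_d :=
  \col_(k < d) rarr s 2 k.

Definition dot (R : realType) (d : nat) (w x : 'cV[R]_d) : R :=
  (w^T *m x) 0 0.

Definition npos (R : realType) (n : nat) (y : 'I_n -> R) : nat :=
  #|[set i | y i == 1]|.

Definition nneg (R : realType) (n : nat) (y : 'I_n -> R) : nat :=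
  #|[set i | y i == -1]|.

Definition linearly_separable (R : realType) (d n : nat)
    (x : 'I_n -> 'cV[R]_d) (y : 'I_n -> R) : Prop :=
  exists w : 'cV[R]_d,
    (forall i, y i = 1 -> 0 <= dot w (x i)) /\
    (forall j, y j = -1 -> dot w (x j) < 0).

Definition AUC (R : realType) (d n : nat)
    (x : 'I_n -> 'cV[R]_d) (y : 'I_n -> R) (w : 'cV[R]_d) : R :=
  \sum_(i < n | y i == 1) \sum_(j < n | y j == -1)
    ((dot w (x i) > dot w (x j))%R)%:R / (npos y * nneg y)%:R.

Definition is_argmax (R : realType) (T : Type) (f : T -> R) (w : T) : Prop :=
  forall v : T, f v <= f w.

(* Main.v *)
(* Maximizing the AUC means finding a vector [w] with [0 < <w, z>] for as many
   as possible of the [N] difference vectors [z = x_i^+ - x_j^-].  Inside a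
   subspace [V], let [v] be optimal and let [z] be the strictly satisfied
   constraint whose boundary is nearest to [v].  Projecting [v] onto that
   boundary violates nothing, and only constraints whose normals project to
   positive multiples of the projection [p] of [z] become tight; so an optimal
   vector of [V] is [u + eps p], with [u] optimal in the hyperplane of [V]
   orthogonal to [p] and [eps > 0] small.  Trying every [z] costs a factor [N]
   per dimension.  In a plane the candidates are [a + t b], where [a] and [b]
   come from finitely many choices of coordinate vectors; each constraint is
   then a half-line in [t], and sorting the breakpoints followed by a sweep
   finds the best [t] in time [O(N log N)].  Every candidate is evaluated
   directly, so only the existence of a good branch has to be proved. *)

Require Import Defs.
From mathcomp Require Import all_boot all_order all_algebra.
From mathcomp Require Import reals exp.
From mathcomp Require Import zify ring lra.

Set Implicit Arguments.
Unset Strict Implicit.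
Unset Printing Implicit Defensive.

Import Order.TTheory GRing.Theory Num.Theory.
Local Open Scope ring_scope.

(** * Orthogonal projections *)

(** An exact algorithm has no infinitesimal step: once the problem in a hyperplane is solved, one
    more pass over the differences computes an explicit step that spoils no strict inequality. The
    nearest constraint is not known to the program, so most branches are wrong and some directions
    project to 0. Such branches must be harmless rather than optimal, which is why the specification
    [level_best] is a relation that also holds for them, and why optimality is extracted from a
    single branch afterwards. This relation mentions no program, so geometry and execution are
    proved separately. The descent stops at planes because one more stage would cost [N ^ 2] per
    plane: [N] candidates, each evaluated in linear time. Thus [d - 2] loops of length [N] surround
    a search of cost [N log N], which gives the exponent [d - 1]. The two directions spanning a
    plane come from signed coordinate vectors, at most [2 d] choices each, because their number must
    not depend on [N]. *)

Section Dot.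
Variables (R : realType) (d : nat).
Implicit Types (u v w p q : 'cV[R]_d) (qs : seq 'cV[R]_d).

Lemma dotE u v : dot u v = \sum_(i < d) u i 0 * v i 0.
Proof. by rewrite /dot mxE; apply: eq_bigr => i _; rewrite mxE. Qed.

Lemma dotC u v : dot u v = dot v u.
Proof. by rewrite !dotE; apply: eq_bigr => i _; rewrite mulrC. Qed.

Lemma dotDr u v w : dot u (v + w) = dot u v + dot u w.
Proof. by rewrite /dot mulmxDr mxE. Qed.

Lemma dotZr u a v : dot u (a *: v) = a * dot u v.
Proof. by rewrite /dot -scalemxAr mxE. Qed.

Lemma dotNr u v : dot u (- v) = - dot u v.
Proof. by rewrite -scaleN1r dotZr mulN1r. Qed.

Lemma dot0r u : dot u 0 = 0.
Proof. by rewrite -(scale0r u) dotZr mul0r. Qed.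

Lemma dotDl u v w : dot (v + w) u = dot v u + dot w u.
Proof. by rewrite dotC dotDr !(dotC u). Qed.

Lemma dotZl u a v : dot (a *: v) u = a * dot v u.
Proof. by rewrite dotC dotZr dotC. Qed.

Lemma dotNl u v : dot (- v) u = - dot v u.
Proof. by rewrite dotC dotNr dotC. Qed.

Lemma dot0l u : dot 0 u = 0.
Proof. by rewrite dotC dot0r. Qed.

Definition dotL := (dotDl, dotNl, dotZl, dot0l, dotDr, dotNr, dotZr, dot0r).

Lemma dotvv_ge0 v : 0 <= dot v v.
Proof. by rewrite dotE sumr_ge0 // => i _; rewrite -expr2 sqr_ge0. Qed.

Lemma dotvv_eq0 v : (dot v v == 0) = (v == 0).
Proof.
rewrite dotE psumr_eq0 => [|i _]; last by rewrite -expr2 sqr_ge0.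
apply/allP/eqP => [h|-> i _]; last by rewrite mxE mul0r eqxx.
apply/colP => i; rewrite mxE; apply/eqP.
by have := h i (mem_index_enum i); rewrite /= mulf_eq0 orbb.
Qed.

Lemma dotvv_gt0 v : (0 < dot v v) = (v != 0).
Proof. by rewrite lt0r dotvv_ge0 dotvv_eq0 andbT. Qed.

(** The vector [x] is the component of [q] orthogonal to [p], multiplied by [dot p p] to avoid a
    division. Nonnegativity of its square gives Cauchy-Schwarz, and its vanishing gives the equality
    case used in [descent]. *)
Lemma dotvv_scaled p q :
  let x := dot p p *: q - dot p q *: p in
  dot x x = dot p p * (dot p p * dot q q - dot p q ^+ 2).
Proof. by rewrite /= !dotL (dotC q p); ring. Qed.

Lemma cauchy_schwarz p q : dot p q ^+ 2 <= dot p p * dot q q.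
Proof.
have [->|p0] := eqVneq p 0; first by rewrite !dot0l mul0r expr0n.
have := dotvv_ge0 (dot p p *: q - dot p q *: p).
by rewrite dotvv_scaled pmulr_rge0 ?dotvv_gt0 // subr_ge0.
Qed.

Definition perp qs v := all (fun q => dot q v == 0) qs.

Definition orthog qs := pairwise (fun p q => dot p q == 0) qs.

(** Zero directions occur in branches tried in vain, so nonvanishing is kept apart from [orthog] and
    asked for only where dimensions are counted. *)
Definition orthog_neq0 qs := orthog qs && all (fun q => q != 0) qs.

(** Each coefficient is taken from the partially projected vector, as in the in-place update made by
    [project]. A zero [q] subtracts nothing. *)
Definition proj qs v :=
  foldr (fun q p => p - (dot q p / dot q q) *: q) v qs.

Lemma perpP qs v : reflect (forall q, q \in qs -> dot q v = 0) (perp qs v).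
Proof. by apply: (iffP allP) => h q /h /eqP. Qed.

Lemma perp0 qs : perp qs 0.
Proof. by apply/perpP => q _; rewrite dot0r. Qed.

Lemma perpD qs a u v : perp qs u -> perp qs v -> perp qs (u + a *: v).
Proof.
move=> /perpP hu /perpP hv; apply/perpP => q hq.
by rewrite !dotL hu // hv // mulr0 addr0.
Qed.

Lemma orthog_cons q qs : orthog (q :: qs) = perp qs q && orthog qs.
Proof.
rewrite /orthog /= /perp; congr (_ && _).
by apply: eq_all => p; rewrite dotC.
Qed.

Lemma orthog_neq0_cons q qs :
  orthog_neq0 (q :: qs) = [&& perp qs q, q != 0 & orthog_neq0 qs].
Proof.
by rewrite /orthog_neq0 orthog_cons /= -!andbA; do !bool_congr.
Qed.

Lemma orthog_neq0W qs : orthog_neq0 qs -> orthog qs.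
Proof. by case/andP. Qed.

Lemma perp_proj qs v : orthog qs -> perp qs (proj qs v).
Proof.
elim: qs => // q qs IH; rewrite orthog_cons => /andP[qqs /IH h].
rewrite /perp /=; apply/andP; split; last first.
  by rewrite -/(perp _ _) -scaleNr; apply: perpD.
have [->|q0] := eqVneq q 0; first by rewrite dot0l.
by rewrite !dotL divfK ?subrr // dotvv_eq0.
Qed.

Lemma dot_proj qs w v : perp qs w -> dot w (proj qs v) = dot w v.
Proof.
elim: qs => //= q qs IH /andP[/eqP qw /IH h].
by rewrite !dotL h (dotC w q) qw mulr0 subr0.
Qed.

Lemma projN qs v : proj qs (- v) = - proj qs v.
Proof.
by elim: qs => //= q qs ->; rewrite dotNr mulNr scaleNr opprD !opprK.
Qed.

(** With the vectors [q] as rows, the columns [q / dot q q] form an explicit right inverse. Both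
    dimension counts below are read off this matrix. *)
Lemma basis_mx_row_free qs : orthog_neq0 qs ->
  exists M : 'M[R]_(size qs, d),
    row_free M /\ forall v, M *m v = 0 <-> perp qs v.
Proof.
move=> oqs; pose M : 'M[R]_(size qs, d) := \matrix_(i, j) (qs`_i) j 0.
have Mv v i : (M *m v) i 0 = dot qs`_i v.
  by rewrite mxE dotE; apply: eq_bigr => j _; rewrite mxE.
exists M; split; last first.
  move=> v; split => [h|/perpP h]; last first.
    by apply/colP => i; rewrite Mv h ?mem_nth // mxE.
  apply/perpP => q /(nthP 0)[i hi <-].
  by have := Mv v (Ordinal hi); rewrite h mxE.
have dij i j : (i < size qs)%N -> (j < size qs)%N -> i != j ->
    dot qs`_i qs`_j = 0.
  case/andP: oqs => oqs _; move/(pairwiseP 0): oqs => h hi hj; rewrite neq_ltn.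
  by case/orP => hij; [|rewrite dotC]; apply/eqP/h.
apply/row_freeP; exists (\matrix_(i, j) (qs`_j i 0 / dot qs`_j qs`_j)).
apply/matrixP => i j; rewrite !mxE.
under eq_bigr do rewrite !mxE mulrA.
rewrite -mulr_suml -dotE; have [->|ij] := eqVneq i j.
  rewrite divff // dotvv_eq0; case/andP: oqs => _ /allP; apply.
  exact: mem_nth.
by rewrite dij // mul0r.
Qed.

Lemma perp_full qs v : orthog_neq0 qs -> size qs = d -> perp qs v -> v = 0.
Proof.
move=> /basis_mx_row_free[M [fM MP]] sz /MP.
move: M fM MP; rewrite sz => M; rewrite row_free_unit => uM _ h.
by rewrite -(mulKmx uM v) h mulmx0.
Qed.

Lemma exists_perp qs : (size qs < d)%N -> orthog_neq0 qs ->
  exists2 v, perp qs v & v != 0.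
Proof.
move=> sz /basis_mx_row_free[M [fM MP]].
have : kermx M^T != 0.
  rewrite -mxrank_eq0 mxrank_ker subn_eq0 -ltnNge mxrank_tr.
  exact: leq_ltn_trans (rank_leq_row _) sz.
move=> /rowV0Pn[v /sub_kermxP vM v0].
exists v^T; last by rewrite -trmx0 (inj_eq trmx_inj).
by apply/MP; rewrite -[M]trmxK -trmx_mul vM trmx0.
Qed.

(** The entry [0 - 1] mirrors the expression evaluated by the machine, whose real literals are
    natural numbers. *)
Definition axis (neg : bool) (c : nat) : 'cV[R]_d :=
  \col_i (if i == c :> nat then (if neg then 0 - 1 else 1) else 0).

Lemma axisN c : axis true c = - axis false c.
Proof. by apply/colP => i; rewrite !mxE; case: eqP; rewrite ?oppr0 ?sub0r. Qed.

Lemma dot_axis v (c : 'I_d) : dot v (axis false c) = v c 0.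
Proof.
rewrite dotE (bigD1 c) //= big1 ?addr0 => [|i ic]; rewrite mxE ?eqxx ?mulr1 //.
by rewrite val_eqE (negbTE ic) mulr0.
Qed.

(** A nonzero [v] orthogonal to [qs] has the same product with a coordinate vector as with its
    projection; if all these projections vanished, so would every coordinate of [v]. *)
Lemma proj_axis_neq0 qs : (size qs < d)%N -> orthog_neq0 qs ->
  exists2 c, (c < d)%N & proj qs (axis false c) != 0.
Proof.
move=> sz oqs; have [v vq] := exists_perp sz oqs.
rewrite -dotvv_eq0 => v0.
have /existsP[c hc] : [exists c : 'I_d, proj qs (axis false c) != 0].
  apply: contraNT v0; rewrite negb_exists => /forallP h.
  rewrite dotE big1 // => c _.
  have /negPn/eqP pc := h c.
  by rewrite -dot_axis -(dot_proj _ vq) pc dot0r mulr0.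
by exists (c : nat) => //; apply: ltn_ord.
Qed.

End Dot.

(** * Reduction of the dimension *)

Section Descent.
Variables (R : realType) (d N : nat) (Z : nat -> 'cV[R]_d).
Implicit Types (u v w p q : 'cV[R]_d) (qs : seq 'cV[R]_d).

Definition wins w : nat := (\sum_(k < N) (0 < dot w (Z k))%R)%N.

Definition safe_step u q eps :=
  0 < eps /\
  forall k, (k < N)%N -> 0 < dot u (Z k) -> 0 < dot (u + eps *: q) (Z k).

Lemma wins_scale a w : 0 < a -> wins (a *: w) = wins w.
Proof. by move=> a0; apply: eq_bigr => k _; rewrite dotZl pmulr_rgt0. Qed.

Lemma wins_safe_step u q eps : safe_step u q eps ->
  (wins u <= wins (u + eps *: q))%N.
Proof.
case=> _ h; apply: leq_sum => k _.
by case: (ltrP 0 (dot u (Z k))) => // /h ->.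
Qed.

Lemma exists_safe_step u q : exists eps, safe_step u q eps.
Proof.
rewrite /safe_step; elim: N => [|n [e [e0 he]]]; first by exists 1.
have [un|un] := ltrP 0 (dot u (Z n)); last first.
  exists e; split => // k; rewrite ltnS leq_eqVlt => /orP[/eqP->|/he//].
  by rewrite ltNge un.
(* With [x = dot q (Z n)], any positive [m <= e'] gives [dot u (Z n) + m * x >= m * (1 + x + x ^ 2)
   > 0]. This denominator never vanishes, so the sign of [x] does not matter. *)
pose e' := dot u (Z n) / (1 + dot q (Z n) ^+ 2).
have den : 0 < 1 + dot q (Z n) ^+ 2 by rewrite ltr_wpDr ?sqr_ge0.
have e'0 : 0 < e' by rewrite divr_gt0.
exists (Num.min e e'); split; first by rewrite lt_min e0.
move=> k; rewrite ltnS leq_eqVlt => /orP[/eqP->|kn] uk.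
  have le' : Num.min e e' <= e' by rewrite ge_min lexx orbT.
  have m0 : 0 < Num.min e e' by rewrite lt_min e0.
  rewrite !dotL; move: le'; rewrite ler_pdivlMr //.
  move: (Num.min e e') (dot q (Z n)) m0 => m x m0 le.
  have : 0 < m * (1 + x + x ^+ 2) by rewrite mulr_gt0 //; nra.
  by move: le; lra.
have := he k kn uk; rewrite !dotL.
have le' : Num.min e e' <= e by rewrite ge_min lexx.
have m0 : 0 < Num.min e e' by rewrite lt_min e0.
move: (Num.min e e') (dot q (Z k)) m0 le' => m x m0 le' h.
have [x0|x0] := lerP 0 x; nra.
Qed.

(* Among the constraints that [v] satisfies strictly, take the one whose
   boundary is nearest and let [u] be the foot of the perpendicular from [v].
   No other satisfied constraint becomes violated at [u], and those that become
   tight are positive multiples of the nearest one, so they are recovered by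
   stepping from the boundary back along [proj qs (Z k)]. *)
Lemma descent qs v : orthog qs -> perp qs v -> (0 < wins v)%N ->
  exists2 k, (k < N)%N & let p := proj qs (Z k) in p != 0 /\
    forall w eps, perp (p :: qs) w -> safe_step w p eps ->
    (forall u, perp (p :: qs) u -> (wins u <= wins w)%N) ->
    (wins v <= wins (w + eps *: p))%N.
Proof.
move=> oqs vqs v0; pose P j := proj qs (Z j).
have vP j : dot v (Z j) = dot v (P j) by rewrite dot_proj.
have [k0 k0P] : exists k : 'I_N, 0 < dot v (Z k).
  apply/existsP; apply: contraLR v0; rewrite negb_exists -leqNgt => /forallP h.
  by rewrite /wins big1 // => k _; rewrite (negbTE (h k)).
(* The squared distance from [v] to the boundary of constraint [k], measured inside the subspace. *)
pose F (k : 'I_N) := dot v (Z k) ^+ 2 / dot (P k) (P k).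
have P_gt0 j : 0 < dot v (Z j) -> 0 < dot (P j) (P j).
  rewrite vP dotvv_gt0; apply: contraTneq => ->.
  by rewrite dot0r ltxx.
pose S (k : 'I_N) := 0 < dot v (Z k).
case: (@Order.TotalTheory.arg_minP _ _ _ k0 S F k0P) => k kP kmin.
have pk := P_gt0 _ kP.
exists k => //=; rewrite -/(P k); split; first by rewrite -dotvv_gt0.
move=> w eps /= /andP[/eqP wp wqs] [e0 safe] wmax.
set p := P k in pk wp safe wmax *.
pose u := v - (dot v (Z k) / dot p p) *: p.
have pqs : perp qs p by apply: perp_proj.
have uperp : perp (p :: qs) u.
  rewrite /perp /= -/(perp _ _); apply/andP; split; last first.
    by rewrite /u -scaleNr; apply: perpD.
  by rewrite /u !dotL vP (dotC p) divfK ?subrr // gt_eqF.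
have uZ j : dot p p * dot u (Z j) =
    dot p p * dot v (Z j) - dot v (Z k) * dot p (P j).
  rewrite /u !dotL -[dot p (Z j)](dot_proj _ pqs) -/(P j); field;
    exact: lt0r_neq0.
have near j : (j < N)%N -> 0 < dot v (Z j) ->
    dot v (Z k) ^+ 2 * dot (P j) (P j) <= dot v (Z j) ^+ 2 * dot p p.
  move=> jN hj; have := kmin (Ordinal jN) hj; rewrite /F /= => le.
  by move: le; rewrite ler_pdivrMr // mulrAC ler_pdivlMr ?P_gt0.
pose par (j : nat) := (0 < dot v (Z j)) && (dot u (Z j) == 0).
have vu : (wins v <= wins u + \sum_(j < N) par j)%N.
  rewrite /wins -big_split /=; apply: leq_sum => j _; rewrite /par.
  have [hj|//] := ltrP 0 (dot v (Z j)).
  suff : 0 <= dot u (Z j) by rewrite le0r => /orP[/eqP->|->];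
    rewrite ?eqxx ?ltxx.
  (* The goal is now [dot v (Z k) * dot p (P j) <= dot p p * dot v (Z j)]. It is trivial if
     [dot p (P j) <= 0]; otherwise squaring reduces it to Cauchy-Schwarz and the minimality of
     [k]. *)
  rewrite -(pmulr_rge0 _ pk) uZ subr_ge0.
  have [c0|c0] := lerP (dot p (P j)) 0.
    apply: (@le_trans _ _ 0); first by rewrite mulr_ge0_le0 // ltW.
    by rewrite mulr_ge0 // ltW.
  rewrite -(@ler_pXn2r _ 2) // ?nnegrE ?mulr_ge0 ?(ltW hj) ?(ltW kP) ?(ltW pk)
    ?(ltW c0) //.
  rewrite !exprMn.
  have := near j (ltn_ord j) hj; have := cauchy_schwarz p (P j).
  have := sqr_ge0 (dot v (Z k)).
  move: (dot v (Z k) ^+ 2) (dot v (Z j) ^+ 2) (dot p (P j) ^+ 2)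
    (dot p p) (dot (P j) (P j)) pk => A B c a b a0 A0 cs nr.
  apply: (@le_trans _ _ (A * (a * b))); first by rewrite ler_wpM2l.
  by rewrite expr2 -mulrA; nra.
have wp' : (wins w + \sum_(j < N) par j <= wins (w + eps *: p))%N.
  rewrite /wins -big_split /=; apply: leq_sum => j _.
  have [hj|hj] := boolP (par j); last first.
    by case: (ltrP 0 (dot w (Z j))) => // /safe ->.
  case/andP: hj => hj /eqP uj.
  have eqj : dot p p * dot v (Z j) = dot v (Z k) * dot p (P j).
    by apply/eqP; rewrite -subr_eq0 -uZ uj mulr0.
  have c0 : 0 < dot p (P j).
    by rewrite -(pmulr_rgt0 _ kP) -eqj mulr_gt0.
  (* Tightness at [u] turns the minimality of [k] into the reverse of Cauchy-Schwarz. Hence [P j] is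
     a positive multiple of [p], so [w] is tight there too and the step along [p] wins it. *)
  have cs : dot p p * dot (P j) (P j) <= dot p (P j) ^+ 2.
    have : dot v (Z k) ^+ 2 * (dot p p * dot (P j) (P j)) <=
      dot v (Z k) ^+ 2 * dot p (P j) ^+ 2.
      rewrite -exprMn -eqj exprMn; have := near j (ltn_ord j) hj.
      move: (dot v (Z k) ^+ 2) (dot v (Z j) ^+ 2)
        (dot p p) (dot (P j) (P j)) pk => A B a b a0 nr; nra.
    by rewrite ler_pM2l ?exprn_gt0.
  have : dot p p *: P j - dot p (P j) *: p == 0.
    rewrite -dotvv_eq0 eq_le dotvv_ge0 andbT dotvv_scaled.
    by rewrite pmulr_rle0 // subr_le0.
  rewrite subr_eq0 => /eqP Pj.
  have wj : dot w (Z j) = 0.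
    rewrite -(dot_proj _ wqs) -/(P j); apply: (mulfI (lt0r_neq0 pk)).
    by rewrite -dotZr Pj dotZr (dotC w) wp !mulr0.
  rewrite !dotL wj ltxx add0r add0n -[dot p (Z j)](dot_proj _ pqs) -/(P j).
  by rewrite mulr_gt0.
(* [u] competes with [w] in the smaller subspace; what [v] loses at [u], counted by [par], is
   regained by the final step. *)
by apply: leq_trans vu (leq_trans _ wp'); rewrite leq_add2r wmax.
Qed.

Definition axis_dir (c : nat) : 'cV[R]_d :=
  if (c < d)%N then axis R d false c else axis R d true (c - d).

(** Vacuous on fewer than two directions, where there is no line to search. *)
Definition line_best (qs : seq 'cV[R]_d) W :=
  forall a b qs', qs = b :: a :: qs' ->
  (exists t, W = a + t *: b) /\ forall t, (wins (a + t *: b) <= wins W)%N.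

(* What the program computes at depth [m], [qs] being the directions chosen at
   the outer depths. *)
Fixpoint level_best (m : nat) (qs : seq 'cV[R]_d) (W : 'cV[R]_d) : Prop :=
  match m with
  | 0 => line_best qs W
  | m'.+1 =>
    let cand k W0 := exists W' eps,
      let q := proj qs (if (m' < 2)%N then axis_dir k else Z k) in
      [/\ level_best m' (q :: qs) W', safe_step W' q eps
        & W0 = W' + eps *: q] in
    (W = 0 \/ exists k, cand k W) /\
    forall k, (k < if (m' < 2)%N then (d + d)%N else N)%N ->
      exists2 W0, cand k W0 & (wins W0 <= wins W)%N
  end.

Lemma axis_dirP (neg : bool) c : (c < d)%N ->
  exists2 k, (k < d + d)%N & axis_dir k = axis R d neg c.
Proof.
move=> cd; case: neg; [exists (d + c)%N|exists c]; rewrite /axis_dir.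
- by rewrite ltn_add2l.
- by rewrite ltnNge leq_addr /= addKn.
- exact: ltn_addr.
- by rewrite cd.
Qed.

Lemma line_perp qs q W : orthog qs -> perp qs q ->
  level_best 1 (q :: qs) W -> perp qs W.
Proof.
move=> oqs pq [[->|[k [W2 [e [lb _ ->]]]]] _]; first exact: perp0.
have [[t ->] _] := lb _ _ _ erefl.
have pb : perp qs (proj (q :: qs) (axis_dir k)).
  by rewrite /= -scaleNr; apply/perpD/pq/perp_proj.
by apply/perpD/pb/perpD/pb.
Qed.

(** A vector of the plane with positive product with [a] is a positive multiple of some [a + t b],
    and [wins] ignores positive scaling. One coordinate vector with nonzero projection, taken with
    both signs, thus covers all of the plane except a line; a vector on that line is first moved off
    it by a safe step. *)
Lemma plane_best qs W : orthog_neq0 qs -> (size qs + 2)%N = d ->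
  level_best 2 qs W -> forall v, perp qs v -> (wins v <= wins W)%N.
Proof.
move=> onqs sz [Wor Wbest]; have oqs := orthog_neq0W onqs.
have [|c cd a0] := @proj_axis_neq0 _ d qs _ onqs; first by lia.
have pos neg v : perp qs v -> 0 < dot (proj qs (axis R d neg c)) v ->
    (wins v <= wins W)%N.
  move=> vqs; have [k kd <-] := axis_dirP neg cd => av.
  have [W02 [W1 [e1 [lb1 /wins_safe_step s1 ->]]]] := Wbest k kd.
  apply: leq_trans; apply: leq_trans s1.
  set a := proj qs _ in av lb1.
  have oa : orthog_neq0 (a :: qs).
    rewrite orthog_neq0_cons onqs perp_proj //= andbT.
    by apply: contraTneq av => ->; rewrite dot0l ltxx.
  have [|c' cd' b0] := @proj_axis_neq0 _ d (a :: qs) _ oa.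
    by rewrite /=; lia.
  have [k' kd' kE] := axis_dirP false cd'.
  have [W01 [W2 [e2 []]]] := lb1.2 k' kd'.
  rewrite kE; set b := proj _ _ in b0 *.
  move=> lb2 /wins_safe_step s2 ->.
  apply: leq_trans; apply: leq_trans s2.
  have [_ lbest] := lb2 _ _ _ erefl.
  have ob : orthog_neq0 (b :: a :: qs).
    by rewrite orthog_neq0_cons oa b0 perp_proj // orthog_neq0W.
  have a_gt0 : 0 < dot a a.
    by rewrite dotvv_gt0; move: oa; rewrite orthog_neq0_cons => /and3P[].
  have b_gt0 : 0 < dot b b by rewrite dotvv_gt0.
  have /andP[/eqP ab pb] : perp (a :: qs) b.
    exact/perp_proj/orthog_neq0W.
  have pa : perp qs a by apply: perp_proj.
  clearbody b; clearbody a.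
  pose x := dot a v / dot a a; pose y := dot b v / dot b b.
  have vE : v - x *: a - y *: b = 0.
    apply: (perp_full ob); first by rewrite /= -addn2.
    rewrite /perp /= -/(perp _ _); apply/and3P; split.
    - by rewrite !dotL (dotC b a) ab /y (divfK (lt0r_neq0 b_gt0)) mulr0 subr0
        subrr.
    - by rewrite !dotL ab /x (divfK (lt0r_neq0 a_gt0)) mulr0 subr0 subrr.
    - by rewrite -!scaleNr; apply/perpD/pb/perpD/pa.
  have x0 : 0 < x by rewrite divr_gt0.
  have -> : v = x *: (a + (y / x) *: b).
    rewrite scalerDr scalerA mulrCA divff ?gt_eqF // mulr1.
    by apply/eqP; rewrite -subr_eq0 opprD addrA vE.
  by rewrite wins_scale.
move=> v vqs; case: (ltrgt0P (dot (proj qs (axis R d false c)) v)) => av.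
- exact: pos av.
- by apply: (pos true) => //; rewrite axisN projN dotNl oppr_gt0.
have [e es] := exists_safe_step v (proj qs (axis R d false c)).
apply: leq_trans (wins_safe_step es) _; apply: (pos false).
  exact/perpD/perp_proj.
by rewrite !dotL av add0r mulr_gt0 ?es.1 // dotvv_gt0.
Qed.

(** Supplies the orthogonality that [descent] requires of [w]. At depths 0 and 1 the result is built
    on directions already in [qs], so it is not orthogonal to them. *)
Lemma level_best_perp m qs W : (1 < m)%N -> orthog qs ->
  level_best m qs W -> perp qs W.
Proof.
elim: m qs W => // m IH qs W; rewrite ltnS => m0 oqs /= [+ _].
case=> [->|[k [W' [e [lb _ ->]]]]]; first exact: perp0.
have pq v : perp qs (proj qs v) by apply: perp_proj.
apply/perpD/pq; move: m0 lb; rewrite leq_eqVlt => /orP[/eqP<-|m1].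
  exact: line_perp.
by move=> /(IH _ _ m1); rewrite orthog_cons pq => /(_ oqs) /andP[].
Qed.

(** Above the plane, only the branch named by [descent] for [v] matters; its direction is nonzero,
    so the induction hypothesis applies in one dimension less. A [v] without any win needs no
    branch. *)
Lemma level_best_max m qs W v : (1 < m)%N -> (size qs + m)%N = d ->
  orthog_neq0 qs -> level_best m qs W -> perp qs v -> (wins v <= wins W)%N.
Proof.
elim: m qs W v => // m IH qs W v; rewrite ltnS leq_eqVlt => /orP[/eqP<-|m1].
  by move=> sz oqs lb; apply: plane_best.
have m2 : (m < 2)%N = false by lia.
move=> sz oqs /= [_]; rewrite m2 => Wbest vqs.
have [->//|v0] := posnP (wins v).
have [k kN [p0 desc]] := descent (orthog_neq0W oqs) vqs v0.
have [W0 [W' [e [lb safe ->]]]] := Wbest k kN.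
have oq : orthog_neq0 (proj qs (Z k) :: qs).
  by rewrite orthog_neq0_cons perp_proj ?orthog_neq0W ?p0.
apply: leq_trans; apply: desc safe _ => [|u uq].
  exact: level_best_perp (orthog_neq0W oq) lb.
by apply: IH lb uq; rewrite //= addSnnS.
Qed.
End Descent.

(** * Merge sort and the sweep over a line *)

Section MergePass.
Variables (T : eqType) (le : rel T).
Hypotheses (le_total : total le) (le_trans : transitive le).
Local Open Scope nat_scope.
Implicit Types (s : seq T) (w n : nat).

(** The recursive call is on [drop], hence the fuel. For positive [w] each block of a nonempty list
    is nonempty, so [size s] is enough, and surplus fuel merges empty runs. *)
Fixpoint merge_pass_fuel n w s :=
  if n is n'.+1 then
    merge le (take w s) (take w (drop w s)) ++
      merge_pass_fuel n' w (drop (w + w) s)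
  else [::].

Definition merge_pass w s := merge_pass_fuel (size s) w s.

Lemma merge_pass_fuel_nil n w : merge_pass_fuel n w [::] = [::].
Proof. by elim: n => //= n ->. Qed.

Lemma merge_pass_fuelE n w s : 0 < w -> size s <= n ->
  merge_pass_fuel n w s = merge_pass w s.
Proof.
move=> w0; rewrite /merge_pass.
suff h m : size s <= m -> size s <= n ->
  merge_pass_fuel n w s = merge_pass_fuel m w s by apply: h.
elim: n m s => [|n IH] [|m] [|x s] // hm hn; rewrite ?merge_pass_fuel_nil //.
by rewrite [LHS]/= [RHS]/=; congr (_ ++ _);
  apply: IH; rewrite size_drop; move: hm hn => /=; lia.
Qed.

Lemma merge_pass_step w s : 0 < w ->
  merge_pass w s = merge le (take w s) (take w (drop w s)) ++
    merge_pass w (drop (w + w) s).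
Proof.
move=> w0; rewrite {1}/merge_pass; case: s => //= x s.
by rewrite merge_pass_fuelE // size_drop /=; lia.
Qed.

Lemma size_merge_block w s :
  size (merge le (take w s) (take w (drop w s))) = minn (w + w) (size s).
Proof. by rewrite size_merge size_cat !size_take_min size_drop; lia. Qed.

Lemma merge_pass_nil w : merge_pass w [::] = [::]. Proof. by []. Qed.

Lemma take_merge_pass w s : 0 < w ->
  take (w + w) (merge_pass w s) = merge le (take w s) (take w (drop w s)).
Proof.
move=> w0; rewrite merge_pass_step // take_cat size_merge_block.
have [ge|lt] := leqP (w + w) (size s).
  by rewrite ltnn subnn take0 cats0.
rewrite [drop (w + w) s]drop_oversize ?merge_pass_nil ?cats0; last exact: ltnW.
by case: ifP => // _; rewrite take_oversize // size_merge_block geq_minl.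
Qed.

Lemma drop_merge_pass w s : 0 < w ->
  drop (w + w) (merge_pass w s) = merge_pass w (drop (w + w) s).
Proof.
move=> w0; rewrite {1}merge_pass_step // drop_cat size_merge_block.
have [ge|lt] := leqP (w + w) (size s).
  by rewrite ltnn subnn drop0.
rewrite [drop (w + w) s]drop_oversize ?merge_pass_nil //; last exact: ltnW.
by case: ifP => // _; rewrite drop_oversize // size_merge_block geq_minl.
Qed.

Lemma perm_merge_pass w s : 0 < w -> perm_eq (merge_pass w s) s.
Proof.
move=> w0; rewrite /merge_pass.
suff h m : size s <= m -> perm_eq (merge_pass_fuel m w s) s by apply: h.
elim: m s => [|m IH] s hm; first by case: s hm.
rewrite [merge_pass_fuel _ _ _]/=.
apply: perm_trans (_ : perm_eq _ (take (w + w) s ++ drop (w + w) s)) _.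
  apply: perm_cat; last by apply: IH; rewrite size_drop; lia.
  by rewrite perm_merge takeD perm_refl.
by rewrite cat_take_drop.
Qed.

Definition sorted_runs w s := forall m, sorted le (take w (drop (m * w) s)).

Lemma sorted_runs1 s : sorted_runs 1 s.
Proof. by move=> m; case: (drop _ s) => [|x [|y u]]. Qed.

Lemma sorted_runs_merge_pass w s : 0 < w ->
  sorted_runs w s -> sorted_runs (w + w) (merge_pass w s).
Proof.
move=> w0 h m.
(* Block [m] of width [w + w] is the merge of blocks [2 m] and [2 m + 1] of width [w]. *)
have -> : drop (m * (w + w)) (merge_pass w s) =
    merge_pass w (drop (m * (w + w)) s).
  elim: m => [|m IH]; first by rewrite !mul0n !drop0.
  by rewrite mulSn -[LHS]drop_drop -[drop (_ + _ * _) s]drop_drop IH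
    drop_merge_pass.
rewrite take_merge_pass //; apply: merge_sorted => //.
  by have := h m.*2; congr (is_true (sorted _ (take _ (drop _ _)))); lia.
by have := h m.*2.+1; rewrite drop_drop;
  congr (is_true (sorted _ (take _ (drop _ _)))); lia.
Qed.

Lemma sorted_runs_full w s : size s <= w -> sorted_runs w s -> sorted le s.
Proof. by move=> sw /(_ 0); rewrite drop0 take_oversize. Qed.

Definition slice i j s := take (j - i) (drop i s).

Lemma slice_nil i j s : j <= i -> slice i j s = [::].
Proof. by rewrite /slice -subn_eq0 => /eqP->; rewrite take0. Qed.

Lemma slice_cons x i j s : i < j -> j <= size s ->
  slice i j s = nth x s i :: slice i.+1 j s.
Proof.
by move=> ij js; rewrite /slice (drop_nth x) ?(leq_trans ij) // -(subnSK ij).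
Qed.

(* [out] has been emitted, the runs [i..mid) and [j..hi) are being merged, and
   everything from [hi] on is untouched. *)
Definition merging w s out i j mid hi :=
  [/\ out ++ merge le (slice i mid s) (slice j hi s) ++
        merge_pass w (drop hi s) = merge_pass w s,
      i <= mid <= j, j <= hi <= size s
    & size out + (mid - i) + (hi - j) = hi].

Lemma merging0 w s : merging w s [::] 0 0 0 0.
Proof. by split; rewrite ?slice_nil ?drop0. Qed.

(** When [hi <= size out], the size equation of the invariant forces both runs to be empty. The
    minima truncate the last runs, the second of which may be empty. *)
Lemma merging_next w s out i j mid hi : 0 < w ->
  merging w s out i j mid hi -> hi <= size out -> size out < size s ->
  let o := size out in
  let mid' := minn (o + w) (size s) in let hi' := minn (mid' + w) (size s) in
  merging w s out o mid' mid' hi' /\ o < hi'.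
Proof.
move=> w0 [eq im jh sz] ho os; have [hE mi hj] : [/\ hi = size out,
  mid <= i & hi <= j] by split; lia.
move: eq; rewrite !slice_nil // hE [merge _ _ _]/= cat0s merge_pass_step //.
move=> {}eq o mid' hi'; split; last by rewrite /hi' /mid' /o; lia.
split; [|by rewrite /hi' /mid' /o; lia..].
rewrite -eq; congr (_ ++ (merge _ _ _ ++ merge_pass _ _));
  rewrite /slice ?drop_drop.
- by rewrite /mid' /minn; case: ltnP => h; [congr take; lia|
    rewrite !take_oversize // size_drop; lia].
- rewrite /hi' /mid' [X in take w (drop X s)]addnC -/o;
    have [h|h] := leqP (size s) (o + w).
    by rewrite !drop_oversize //.
  have [h'|h'] := leqP (o + w + w) (size s); first by congr take; lia.
  by rewrite !take_oversize // size_drop; lia.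
- rewrite /hi' /mid'; have [h|h] := leqP (size s) (o + w + w).
    by rewrite !drop_oversize //; lia.
  by congr drop; lia.
Qed.

Lemma merging_left x w s out i j mid hi : merging w s out i j mid hi ->
  i < mid -> (hi <= j) || le (nth x s i) (nth x s j) ->
  merging w s (rcons out (nth x s i)) i.+1 j mid hi.
Proof.
move=> [eq im jh sz] lt h; split; [|by lia..|by rewrite size_rcons; lia].
rewrite -eq cat_rcons (slice_cons x lt); last by lia.
have [hj|jhi] := leqP hi j; first by rewrite (slice_nil _ hj);
  case: (slice _ _ s).
by rewrite (slice_cons x jhi); [move: h; rewrite leqNgt jhi /= => -> | lia].
Qed.

Lemma merging_right x w s out i j mid hi : merging w s out i j mid hi ->
  j < hi -> (mid <= i) || ~~ le (nth x s i) (nth x s j) ->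
  merging w s (rcons out (nth x s j)) i j.+1 mid hi.
Proof.
move=> [eq im jh sz] lt h; split; [|by lia..|by rewrite size_rcons; lia].
rewrite -eq cat_rcons (slice_cons x lt); last by lia.
have [mi|imid] := leqP mid i; first by rewrite (slice_nil _ mi).
rewrite (slice_cons x imid); last by lia.
by move: h; rewrite leqNgt imid /= => /negbTE->.
Qed.

Lemma merging_done w s out i j mid hi : merging w s out i j mid hi ->
  size out = size s -> out = merge_pass w s.
Proof.
move=> [<- im jh sz] os; rewrite !slice_nil ?drop_oversize; try lia.
by rewrite /= cats0.
Qed.

End MergePass.

Lemma leq_in_count (T : eqType) (a b : pred T) (s : seq T) :
  {in s, forall x, a x -> b x} -> (count a s <= count b s)%N.
Proof.
elim: s => //= x s IH h; apply: leq_add.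
  by have := h x (mem_head _ _); case: (a x) => // ->.
by apply: IH => y ys; apply: h; rewrite inE ys orbT.
Qed.

(** * Constraints along a line, counted through their breakpoints *)

Section Sweep.
Variable R : realType.
Implicit Types (S : seq (R * R)) (t : R) (i : nat).

Definition key_le (x y : R * R) : bool := x.1 <= y.1.

Lemma key_le_total : total key_le.
Proof. by move=> x y; apply: le_total. Qed.

Lemma key_le_trans : transitive key_le.
Proof. by move=> y x z; apply: le_trans. Qed.

(* A pair [(k, b)] stands for the constraint [k < t] if [0 < b], for [t < k]
   if [b < 0], and for no constraint if [b = 0]. *)
Definition hits S t : nat :=
  count (fun x => (0 < x.2) && (x.1 < t) || (x.2 < 0) && (t < x.1)) S.

Definition npos_key S : nat := count (fun x => 0 < x.2) S.
Definition nneg_key S : nat := count (fun x => x.2 < 0) S.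

Definition separates S i t :=
  all (fun x => x.1 < t) (take i S) && all (fun x => t < x.1) (drop i S).

(** The cuts that some [t] distinct from all keys can realise: equal keys are never split. *)
Definition gap S i :=
  forall x y, x \in take i S -> y \in drop i S -> x.1 < y.1.

(** Positive slopes are hit before the cut, negative ones after it. The latter number
    [nneg_key S - nneg_key (take i S)], moved across to avoid natural subtraction. *)
Lemma hits_separates S i t : separates S i t ->
  (hits S t + nneg_key (take i S) = npos_key (take i S) + nneg_key S)%N.
Proof.
case/andP => /allP h1 /allP h2.
rewrite -[in hits S t](cat_take_drop i S) -[in nneg_key S](cat_take_drop i S).
rewrite /hits /nneg_key /npos_key !count_cat.
rewrite -addnA [X in (_ + X)%N]addnC addnA addnA; congr (_ + _)%N; last first.
  apply: eq_in_count => x /h2 tx /=.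
  by rewrite tx [x.1 < t]ltNge (ltW tx) andbF andbT.
congr (_ + _)%N; apply: eq_in_count => x /h1 xt /=.
by rewrite xt [t < _]ltNge (ltW xt) andbF andbT orbF.
Qed.

(** A constraint whose key is [t] itself fails at [t], so cutting just before the first key [>= t]
    loses nothing. This reduces every [t], breakpoints included, to a gap. *)
Lemma hits_gap S t : sorted key_le S -> exists i, [/\ (i <= size S)%N, gap S i &
  (hits S t + nneg_key (take i S) <= npos_key (take i S) + nneg_key S)%N].
Proof.
move=> sS; pose i := find (fun x => t <= x.1) S; exists i.
have h1 x : x \in take i S -> x.1 < t.
  move=> /(nthP x)[j]; rewrite size_take_min => /[!leq_min]/andP[ji jS].
  by rewrite nth_take // => <-; rewrite ltNge (before_find x ji).
have h2 x : x \in drop i S -> t <= x.1.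
  have [/eqP|iS] := posnP (size S - i).
    by rewrite subn_eq0 => le; rewrite drop_oversize.
  move=> /(nthP x)[j]; rewrite size_drop nth_drop => jS <-.
  have iS' : (i < size S)%N by rewrite -subn_gt0.
  have hf : t <= (nth x S i).1 by move: iS'; rewrite -has_find => /(nth_find x).
  apply: le_trans hf _.
  have := @sorted_leq_nth _ _ key_le_trans (fun x =>
    lexx x.1) x S sS i (i + j)%N.
  by rewrite !inE; apply; rewrite ?leq_addr // -ltn_subRL.
split; first exact: find_size.
  by move=> x y /h1 xt /h2; apply: lt_le_trans.
rewrite -[in hits S t](cat_take_drop i S) -[in nneg_key S](cat_take_drop i S).
rewrite /hits /nneg_key /npos_key !count_cat.
rewrite -addnA [X in (_ + X <= _)%N]addnC addnA addnA; apply: leq_add;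
  last first.
  apply: leq_in_count => x /h2 tx /=.
  by rewrite [x.1 < t]ltNge tx andbF /= => /andP[].
rewrite leq_add2r; apply: leq_in_count => x /h1 xt /=.
by rewrite [t < _]ltNge (ltW xt) andbF orbF => /andP[].
Qed.

Lemma gap_lt x0 S i : (0 < i < size S)%N -> gap S i ->
  (nth x0 S i.-1).1 < (nth x0 S i).1.
Proof.
case: i => // i /= iS; apply.
  by rewrite (take_nth x0) ?(ltnW iS) // mem_rcons mem_head.
by rewrite (drop_nth x0) // mem_head.
Qed.

Lemma separatesI x0 S i t : sorted key_le S -> (i <= size S)%N ->
  ((0 < i)%N -> (nth x0 S i.-1).1 < t) ->
  ((i < size S)%N -> t < (nth x0 S i).1) -> separates S i t.
Proof.
move=> sS iS lo hi.
have mono j k : (j <= k)%N -> (k < size S)%N ->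
    (nth x0 S j).1 <= (nth x0 S k).1.
  move=> jk kS.
  have := @sorted_leq_nth _ _ key_le_trans (fun x => lexx x.1) x0 S sS j k.
  by rewrite !inE; apply => //; apply: leq_ltn_trans kS.
apply/andP; split; apply/(all_nthP x0) => k.
  rewrite size_takel // => ki; rewrite nth_take //.
  have i0 : (0 < i)%N by apply: leq_ltn_trans ki.
  apply: le_lt_trans (lo i0); apply: mono; first by rewrite -ltnS prednK.
  by rewrite prednK.
rewrite size_drop nth_drop => ki.
apply: lt_le_trans (hi _) _; first by lia.
by apply: mono; lia.
Qed.

Variables (d N : nat) (Z : nat -> 'cV[R]_d).

Definition breakpoints (a b : 'cV[R]_d) : seq (R * R) :=
  [seq ((0 - dot a (Z k)) / dot b (Z k), dot b (Z k)) | k <- iota 0 N].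

(** A zero slope gives the key a default value, but [hits] ignores such a pair: the constraint is
    constant along the line and belongs to the last sum. *)
Lemma wins_line a b t : wins N Z (a + t *: b) =
  (hits (breakpoints a b) t +
   \sum_(k < N) ((dot b (Z k) == 0) && (0 < dot a (Z k)))%R)%N.
Proof.
rewrite /hits /breakpoints count_map -sum1_count big_mkcond /=.
have -> : iota 0 N = index_iota 0 N by rewrite /index_iota subn0.
rewrite big_mkord -big_split /=.
apply: eq_bigr => k _; rewrite !dotL sub0r.
set x := dot a _; set y := dot b _.
have e : (- x < t * y) = (0 < x + t * y) by rewrite -subr_gt0 opprK addrC.
have [y0|y0|->] := ltrgt0P y.
- by rewrite ltr_pdivrMr // e /= addn0 orbF; case: (0 < _).
- by rewrite ltr_ndivlMr // e /= addn0; case: (0 < _).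
- by rewrite mulr0 addr0.
Qed.

Lemma line_optimum a b S i t : perm_eq S (breakpoints a b) ->
  sorted key_le S -> separates S i t ->
  (forall j, (j <= size S)%N -> gap S j ->
    (npos_key (take j S) + nneg_key (take i S) <=
     npos_key (take i S) + nneg_key (take j S))%N) ->
  forall t', (wins N Z (a + t' *: b) <= wins N Z (a + t *: b))%N.
Proof.
move=> pS sS sep best t'; rewrite !wins_line leq_add2r.
have hE u : hits (breakpoints a b) u = hits S u.
  by apply/esym/permP.
rewrite !hE; have [j [jS gj le]] := hits_gap t' sS.
by have := hits_separates sep; have := best j jS gj; lia.
Qed.

End Sweep.

(** * Semantics of programs *)

Fixpoint loopfree (c : cmd) : bool :=
  match c with
  | Seq c1 c2 | If _ c1 c2 => loopfree c1 && loopfree c2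
  | While _ _ => false
  | _ => true
  end.

(** An upper bound for loop-free commands: a conditional pays for both branches. The value at
    [While] is a placeholder, as it is in [sem]. *)
Fixpoint cmd_cost (c : cmd) : nat :=
  match c with
  | Skip | While _ _ => 1
  | ISet _ e => (icost e).+1
  | RSet _ e => (rcost e).+1
  | IPut _ e1 e2 => (icost e1 + icost e2).+1
  | RPut _ e1 e2 => (icost e1 + rcost e2).+1
  | Seq c1 c2 => (cmd_cost c1 + cmd_cost c2)%N
  | If b c1 c2 => (bcost b + (cmd_cost c1 + cmd_cost c2)).+1
  end.

Fixpoint sets_ivar (c : cmd) (a : nat) : bool :=
  match c with
  | ISet b _ => a == b
  | Seq c1 c2 | If _ c1 c2 => sets_ivar c1 a || sets_ivar c2 a
  | While _ c1 => sets_ivar c1 a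
  | _ => false
  end.

Fixpoint sets_rvar (c : cmd) (a : nat) : bool :=
  match c with
  | RSet b _ => a == b
  | Seq c1 c2 | If _ c1 c2 => sets_rvar c1 a || sets_rvar c2 a
  | While _ c1 => sets_rvar c1 a
  | _ => false
  end.

Fixpoint sets_iarr (c : cmd) (a : nat) : bool :=
  match c with
  | IPut b _ _ => a == b
  | Seq c1 c2 | If _ c1 c2 => sets_iarr c1 a || sets_iarr c2 a
  | While _ c1 => sets_iarr c1 a
  | _ => false
  end.

Fixpoint sets_rarr (c : cmd) (a : nat) : bool :=
  match c with
  | RPut b _ _ => a == b
  | Seq c1 c2 | If _ c1 c2 => sets_rarr c1 a || sets_rarr c2 a
  | While _ c1 => sets_rarr c1 a
  | _ => false
  end.

Definition For (k : nat) (bnd : iexp) (body : cmd) : cmd :=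
  Seq (ISet k (ILit 0))
    (While (BNot (BILe bnd (IVar k)))
      (Seq body (ISet k (IAdd (IVar k) (ILit 1))))).

(** The machine cannot multiply integers, but a factor fixed with the program, such as [d] in row
    addresses, unrolls into additions. *)
Definition imul (m : nat) (e : iexp) : iexp := iter m (IAdd e) (ILit 0).

(** A macro language: since [d] is fixed, a vector expression expands into [d] scalar expressions,
    at a cost that does not depend on the data. *)
Inductive vexp : Type :=
| VZero
| VAxis of bool & nat
| VRow of nat & iexp
| VSub of vexp & vexp
| VAxpy of vexp & nat & vexp.

Section Vectors.
Variable d : nat.

Definition cell (e : iexp) (c : nat) : iexp := IAdd (imul d e) (ILit c).

Fixpoint vcoord (e : vexp) (c : nat) : rexp :=
  match e with
  | VZero => RLit 0
  | VAxis neg k => if c == k then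
      (if neg then RSub (RLit 0) (RLit 1) else RLit 1) else RLit 0
  | VRow a i => RGet a (cell i c)
  | VSub e1 e2 => RSub (vcoord e1 c) (vcoord e2 c)
  | VAxpy e1 r e2 => RAdd (vcoord e1 c) (RMul (RVar r) (vcoord e2 c))
  end.

Fixpoint vput_upto (n : nat) (a : nat) (i : iexp) (e : vexp) : cmd :=
  if n is n'.+1 then
    Seq (vput_upto n' a i e) (RPut a (cell i n') (vcoord e n'))
  else Skip.

Definition vput := vput_upto d.

Fixpoint vdot_upto (n : nat) (e1 e2 : vexp) : rexp :=
  if n is n'.+1 then
    RAdd (vdot_upto n' e1 e2) (RMul (vcoord e1 n') (vcoord e2 n'))
  else RLit 0.

Definition vdot := vdot_upto d.

Lemma loopfree_vput a i e : loopfree (vput a i e).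
Proof. by rewrite /vput; elim: d => //= n ->. Qed.

Lemma sets_ivar_vput a i e b : sets_ivar (vput a i e) b = false.
Proof. by rewrite /vput; elim: d => //= n ->. Qed.

Lemma sets_rvar_vput a i e b : sets_rvar (vput a i e) b = false.
Proof. by rewrite /vput; elim: d => //= n ->. Qed.

Lemma sets_iarr_vput a i e b : sets_iarr (vput a i e) b = false.
Proof. by rewrite /vput; elim: d => //= n ->. Qed.

Lemma sets_rarr_vput a i e b :
  sets_rarr (vput a i e) b = (0 < d)%N && (b == a).
Proof.
by rewrite /vput; elim: d => //= n ->; case: eqP; rewrite ?orbT ?andbF.
Qed.

End Vectors.

Section Semantics.
Variable R : realType.
Implicit Types s : state R.

Fixpoint sem (c : cmd) s : state R :=
  match c with
  | Skip | While _ _ => s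
  | ISet a e => State (upd (ivar s) a (ieval s e)) (rvar s) (iarr s) (rarr s)
  | RSet a e => State (ivar s) (upd (rvar s) a (reval s e)) (iarr s) (rarr s)
  | IPut a e1 e2 => State (ivar s) (rvar s)
      (upd2 (iarr s) a (ieval s e1) (ieval s e2)) (rarr s)
  | RPut a e1 e2 => State (ivar s) (rvar s) (iarr s)
      (upd2 (rarr s) a (ieval s e1) (reval s e2))
  | Seq c1 c2 => sem c2 (sem c1 s)
  | If b c1 c2 => if beval s b then sem c1 s else sem c2 s
  end.

Lemma exec_sem c s : loopfree c ->
  exists2 t, exec c s t (sem c s) & (t <= cmd_cost c)%N.
Proof.
elim: c s => //=; try by move=> *; eexists; [constructor|].
- move=> c1 IH1 c2 IH2 s /andP[/(IH1 s)[t1 e1 le1]].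
  move=> /(IH2 (sem c1 s))[t2 e2 le2].
  by exists (t1 + t2)%N; [apply: exec_seq e1 e2|apply: leq_add].
- move=> b c1 IH1 c2 IH2 s /andP[/(IH1 s)[t1 e1 le1] /(IH2 s)[t2 e2 le2]].
  have [bT|bF] := boolP (beval s b).
    exists (bcost b + t1).+1; first by apply: exec_if; rewrite bT.
    by rewrite ltnS leq_add2l (leq_trans le1) ?leq_addr.
  exists (bcost b + t2).+1; first by apply: exec_if; rewrite (negbTE bF).
  by rewrite ltnS leq_add2l (leq_trans le2) ?leq_addl.
Qed.

(** A frame condition read off the syntax, so that loop invariants only mention what the loop
    changes. *)
Record keeps (c : cmd) s s' : Prop := Keeps {
  keeps_ivar : forall a, ~~ sets_ivar c a -> ivar s' a = ivar s a;
  keeps_rvar : forall a, ~~ sets_rvar c a -> rvar s' a = rvar s a;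
  keeps_iarr : forall a, ~~ sets_iarr c a -> iarr s' a = iarr s a;
  keeps_rarr : forall a, ~~ sets_rarr c a -> rarr s' a = rarr s a }.

Lemma keeps_trans c1 c2 c s s1 s2 :
  keeps c1 s s1 -> keeps c2 s1 s2 ->
  (forall a, sets_ivar c a = sets_ivar c1 a || sets_ivar c2 a) ->
  (forall a, sets_rvar c a = sets_rvar c1 a || sets_rvar c2 a) ->
  (forall a, sets_iarr c a = sets_iarr c1 a || sets_iarr c2 a) ->
  (forall a, sets_rarr c a = sets_rarr c1 a || sets_rarr c2 a) ->
  keeps c s s2.
Proof.
move=> [i1 r1 ia1 ra1] [i2 r2 ia2 ra2] hi hr hia hra; split => a.
- by rewrite hi => /norP[h1 h2]; rewrite i2 // i1.
- by rewrite hr => /norP[h1 h2]; rewrite r2 // r1.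
- by rewrite hia => /norP[h1 h2]; rewrite ia2 // ia1.
- by rewrite hra => /norP[h1 h2]; rewrite ra2 // ra1.
Qed.

Lemma exec_keeps c s t s' : exec c s t s' -> keeps c s s'.
Proof.
elim=> {c s t s'} //.
- by move=> s a e; split => b //= /negbTE ba; rewrite /upd ba.
- by move=> s a e; split => b //= /negbTE ba; rewrite /upd ba.
- by move=> s a e1 e2; split => b //= /negbTE ba; rewrite /upd2 /upd ba.
- by move=> s a e1 e2; split => b //= /negbTE ba; rewrite /upd2 /upd ba.
- move=> c1 c2 s s1 s2 t1 t2 _ k1 _ k2.
  exact: keeps_trans k1 k2 _ _ _ _.
- move=> b c1 c2 s s' t _ [i r ia ra].
  by split => a /= /norP[h1 h2];
    [apply: i|apply: r|apply: ia|apply: ra]; case: ifP.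
- move=> b c s s1 s2 t1 t2 _ _ k1 _ k2.
  by apply: keeps_trans k1 k2 _ _ _ _ => a /=; rewrite orbb.
Qed.

Definition run c s T (Q : state R -> Prop) :=
  exists t s', [/\ exec c s t s', (t <= T)%N & Q s'].

Lemma run_weaken c s T T' (Q Q' : state R -> Prop) :
  run c s T Q -> (T <= T')%N -> (forall s', keeps c s s' -> Q s' -> Q' s') ->
  run c s T' Q'.
Proof.
move=> [t [s' [e le q]]] le' h; exists t, s'; split => //.
  exact: leq_trans le le'.
exact: h (exec_keeps e) q.
Qed.

Lemma run_sem c s T (Q : state R -> Prop) : loopfree c -> (cmd_cost c <= T)%N ->
  (keeps c s (sem c s) -> Q (sem c s)) -> run c s T Q.
Proof.
move=> /(exec_sem s)[t e le] le' q; exists t, (sem c s); split => //.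
  exact: leq_trans le le'.
exact: q (exec_keeps e).
Qed.

Lemma run_seq c1 c2 s T1 T2 T (Q1 Q : state R -> Prop) :
  run c1 s T1 Q1 ->
  (forall s1, keeps c1 s s1 -> Q1 s1 -> run c2 s1 T2 Q) ->
  (T1 + T2 <= T)%N -> run (Seq c1 c2) s T Q.
Proof.
move=> [t1 [s1 [e1 le1 q1]]] h le.
have [t2 [s2 [e2 le2 q2]]] := h s1 (exec_keeps e1) q1.
exists (t1 + t2)%N, s2; split => //; first exact: exec_seq e1 e2.
exact: leq_trans (leq_add le1 le2) le.
Qed.

Definition iset s a v : state R :=
  State (upd (ivar s) a v) (rvar s) (iarr s) (rarr s).

(** An iteration pays [icost bnd + 4] for its test and 4 for the increment. The same amount covers
    the initialisation and the last test, [icost bnd + 6] together. *)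
Definition for_cost bnd := (icost bnd + 8)%N.

(** [I j] is asserted of a state whose counter is already [j], so the increment is built into the
    rule; whatever the loop does not write is recovered from [keeps]. *)
Lemma run_for k bnd body s n T T' (I : nat -> state R -> Prop)
    (Q : state R -> Prop) :
  ~~ sets_ivar body k ->
  (forall s', keeps (For k bnd body) s s' -> ieval s' bnd = n) ->
  I 0 (iset s k 0) ->
  (forall j s', keeps (For k bnd body) s s' -> (j < n)%N -> ivar s' k = j ->
     I j s' ->
     run body s' T (fun s'' => ivar s'' k = j -> I j.+1 (iset s'' k j.+1))) ->
  (forall s', keeps (For k bnd body) s s' -> I n s' -> Q s') ->
  (n * (T + for_cost bnd) + for_cost bnd <= T')%N ->
  run (For k bnd body) s T' Q.
Proof.
move=> kb bndE I0 IS IQ le; pose b := BNot (BILe bnd (IVar k)).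
set F := For k bnd body in bndE IS IQ *.
have keepsW s1 t s2 : keeps F s s1 ->
    exec (Seq body (ISet k (IAdd (IVar k) (ILit 1)))) s1 t s2 -> keeps F s s2.
  by move=> k1 /exec_keeps k2; apply: keeps_trans k1 k2 _ _ _ _ => a /=;
    rewrite ?orbF ?orFb //; case: (a == k); case: (_ body a).
have main m j s1 : (m + j)%N = n -> keeps F s s1 -> ivar s1 k = j -> I j s1 ->
    run (While b (Seq body (ISet k (IAdd (IVar k) (ILit 1))))) s1
      (m * (T + for_cost bnd) + (icost bnd + 4)) Q.
  elim: m j s1 => [|m IH] j s1 mj k1 kj Ij.
    have bF : ~~ beval s1 b by rewrite /= bndE // kj negbK -mj.
    exists (bcost b).+1, s1; split; first exact: exec_while_false bF.
      by rewrite /= /for_cost; lia.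
    by apply: IQ => //; rewrite -mj.
  have bT : beval s1 b by rewrite /= bndE // kj -ltnNge -mj; lia.
  have jn : (j < n)%N by lia.
  have [t [s2 [e2 le2 h2]]] := IS j s1 k1 jn kj Ij.
  have kj2 : ivar s2 k = j by rewrite (keeps_ivar (exec_keeps e2)).
  have e3 : exec (Seq body (ISet k (IAdd (IVar k) (ILit 1)))) s1 (t + 4)
      (iset s2 k j.+1).
    apply: (exec_seq e2); have := exec_iset s2 k (IAdd (IVar k) (ILit 1)).
    by rewrite /= kj2 !addn1.
  have [||||t3 [s3 [e4 le4 q]]] := IH j.+1 (iset s2 k j.+1).
  - by rewrite addnS -addSn.
  - exact: keepsW k1 e3.
  - by rewrite /= /upd eqxx.
  - exact: h2 kj2.
  exists (bcost b + (t + 4) + t3).+1, s3; split => //.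
    exact: exec_while_true bT e3 e4.
  rewrite mulSn; move: le2 le4; rewrite /for_cost /=.
  by move: (m * _)%N => X; lia.
apply: (@run_weaken _ _ (2 + (n * (T + for_cost bnd) + (icost bnd + 4))) _ Q);
  last by [].
- apply: (@run_seq _ _ _ 2 _ _ (fun s1 => s1 = iset s k 0)); last by [].
    exists 2, (iset s k 0); split => //; exact: exec_iset.
  move=> s1 _ ->; apply: (@main n 0) => //; first by rewrite addn0.
    by split => a //= /norP[/negbTE ak _]; rewrite /upd ak.
  by rewrite /= /upd eqxx.
- by apply: leq_trans le; rewrite /for_cost; lia.
Qed.

(** The index of [I] is a variant: it must be positive while the guard holds, which bounds the
    number of iterations by [m]. *)
Lemma run_while b body s m T T' (I : nat -> state R -> Prop)
    (Q : state R -> Prop) :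
  I m s ->
  (forall j s', keeps (While b body) s s' -> I j s' -> beval s' b ->
     (0 < j)%N /\ run body s' T (I j.-1)) ->
  (forall j s', keeps (While b body) s s' -> I j s' -> ~~ beval s' b ->
     Q s') ->
  (m * (T + (bcost b).+1) + (bcost b).+1 <= T')%N ->
  run (While b body) s T' Q.
Proof.
move=> Im IS IQ le; apply: run_weaken _ le (fun _ _ => id).
have main j s1 : keeps (While b body) s s1 -> I j s1 ->
    run (While b body) s1 (j * (T + (bcost b).+1) + (bcost b).+1) Q.
  elim: j s1 => [|j IH] s1 k1 Ij.
    have [/(IS 0 s1 k1 Ij)[]//|bF] := boolP (beval s1 b).
    exists (bcost b).+1, s1; split => //; first exact: exec_while_false bF.
    exact: IQ Ij bF.
  have [bT|bF] := boolP (beval s1 b); last first.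
    exists (bcost b).+1, s1; split; first exact: exec_while_false bF.
      exact: leq_addl.
    exact: IQ Ij bF.
  have [_ [t2 [s2 [e2 le2 I2]]]] := IS j.+1 s1 k1 Ij bT.
  have k2 : keeps (While b body) s s2.
    by apply: keeps_trans k1 (exec_keeps e2) _ _ _ _ => a /=; rewrite orbb.
  have [t3 [s3 [e3 le3 q]]] := IH s2 k2 I2.
  exists (bcost b + t2 + t3).+1, s3; split => //.
    exact: exec_while_true bT e2 e3.
  by rewrite mulSn; lia.
exact: main.
Qed.

Lemma ieval_imul s m e : ieval s (imul m e) = (m * ieval s e)%N.
Proof. by elim: m => //= m ->; rewrite mulSn. Qed.

Variable d : nat.

Definition vec (m : nat -> nat -> R) a i : 'cV[R]_d :=
  \col_c m a (i * d + c)%N.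

Definition veval s e : 'cV[R]_d := \col_c reval s (vcoord d e c).

Lemma veval_row s a i : veval s (VRow a i) = vec (rarr s) a (ieval s i).
Proof. by apply/colP => c; rewrite !mxE /= ieval_imul mulnC. Qed.

Lemma veval_zero s : veval s VZero = 0.
Proof. by apply/colP => c; rewrite !mxE. Qed.

Lemma veval_axis s neg k : veval s (VAxis neg k) = axis R d neg k.
Proof. by apply/colP => c; rewrite !mxE /=; case: eqP => // _; case: neg. Qed.

Lemma veval_sub s e1 e2 : veval s (VSub e1 e2) = veval s e1 - veval s e2.
Proof. by apply/colP => c; rewrite !mxE. Qed.

Lemma veval_axpy s e1 r e2 :
  veval s (VAxpy e1 r e2) = veval s e1 + rvar s r *: veval s e2.
Proof. by apply/colP => c; rewrite !mxE. Qed.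

Definition vevalE :=
  (veval_row, veval_zero, veval_axis, veval_sub, veval_axpy).

Lemma reval_vdot s e1 e2 :
  reval s (vdot d e1 e2) = dot (veval s e1) (veval s e2).
Proof.
rewrite dotE; under eq_bigr do rewrite !mxE.
suff h n : reval s (vdot_upto d n e1 e2) =
    \sum_(i < n) reval s (vcoord d e1 i) * reval s (vcoord d e2 i) by apply: h.
elim: n => [|n IH] /=; first by rewrite big_ord0.
by rewrite big_ord_recr /= IH.
Qed.

Lemma ieval_eq s1 s2 e : ivar s1 = ivar s2 -> iarr s1 = iarr s2 ->
  ieval s1 e = ieval s2 e.
Proof. by move=> hi ha; elim: e => //= [k|k f ->|f -> g ->|f -> g ->];
  rewrite ?hi ?ha. Qed.

(** Coordinate [n] reads only cells in column [n], so an assignment made coordinate by coordinate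
    may overwrite one of its own operands. *)
Lemma vcoord_eq s1 s2 e n : ivar s1 = ivar s2 -> iarr s1 = iarr s2 ->
  rvar s1 = rvar s2 ->
  (forall a i, rarr s1 a (i * d + n)%N = rarr s2 a (i * d + n)%N) ->
  reval s1 (vcoord d e n) = reval s2 (vcoord d e n).
Proof.
move=> hi hia hr hra; elim: e => //= [neg k|a i|e1 -> e2 ->|e1 -> r e2 ->] //.
- by case: eqP => // _; case: neg.
- by rewrite !ieval_imul (ieval_eq i hi hia) mulnC hra.
- by rewrite hr.
Qed.

Lemma cell_range i k n : (n < d)%N ->
  (i * d <= k * d + n < i * d + n)%N = false.
Proof.
move=> nd; have [ki|ik|->] := ltngtP k i; last by lia.
- by have : (k.+1 * d <= i * d)%N by [rewrite leq_mul2r ki orbT]; lia.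
- by have : (i.+1 * d <= k * d)%N by [rewrite leq_mul2r ik orbT]; lia.
Qed.

Lemma sem_vput s a i e : let s' := sem (vput d a i e) s in
  [/\ ivar s' = ivar s, rvar s' = rvar s, iarr s' = iarr s &
  forall b j, rarr s' b j =
  if (b == a) && (ieval s i * d <= j < ieval s i * d + d)%N
  then reval s (vcoord d e (j - ieval s i * d)) else rarr s b j].
Proof.
rewrite /vput; suff h n : (n <= d)%N -> let s' := sem (vput_upto d n a i e) s in
  [/\ ivar s' = ivar s, rvar s' = rvar s, iarr s' = iarr s &
  forall b j, rarr s' b j =
  if (b == a) && (ieval s i * d <= j < ieval s i * d + n)%N
  then reval s (vcoord d e (j - ieval s i * d)) else rarr s b j] by apply: h.
elim: n => [|n IH] nd /=.
  by split => // b j; case: ifP => //; lia.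
have [hi hr hia hra] := IH (ltnW nd); split => //= b j.
rewrite ieval_imul mulnC (ieval_eq i hi hia) /upd2 /upd.
have [->|ba] /= := eqVneq b a; last by rewrite hra (negbTE ba).
rewrite hra eqxx /=; have [->|jn] := eqVneq j (ieval s i * d + n)%N.
  rewrite ifT; last by lia.
  rewrite addKn; apply: vcoord_eq => // c k.
  by rewrite hra cell_range ?andbF.
by congr (if _ then _ else _); lia.
Qed.

Lemma vec_vput s a i e b k : vec (rarr (sem (vput d a i e) s)) b k =
  if (b == a) && (k == ieval s i) then veval s e else vec (rarr s) b k.
Proof.
have [_ _ _ hra] := sem_vput s a i e; apply/colP => c; rewrite mxE hra.
have [->|ba] /= := eqVneq b a; last by rewrite mxE.
have cd := ltn_ord c; have [->|ki] := eqVneq k (ieval s i).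
  by rewrite ifT ?addKn ?mxE //; lia.
rewrite mxE ifF //; move: ki; rewrite neq_ltn => /orP[] lt.
- by have : (k.+1 * d <= ieval s i * d)%N by [rewrite leq_mul2r lt orbT]; lia.
- by have : ((ieval s i).+1 * d <= k * d)%N by [rewrite leq_mul2r lt orbT]; lia.
Qed.

Lemma ivar_vput s a i e : ivar (sem (vput d a i e) s) = ivar s.
Proof. by have [] := sem_vput s a i e. Qed.

Lemma vec_keeps c s s' a i : keeps c s s' -> ~~ sets_rarr c a ->
  vec (rarr s') a i = vec (rarr s) a i.
Proof. by move=> k h; apply/colP => j; rewrite !mxE (keeps_rarr k). Qed.
End Semantics.

(** * The program *)

(* Memory layout.  Integer variables: 0 the size of the dataset, 1 the number
   of difference vectors, 2 and 14 the numbers of positive and negative samples,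
   3 to 13 temporaries.  Real arrays: 0 to 2 are imposed by [input] and
   [output]; a vector occupies a row of [d] consecutive cells, and a single
   vector is row 0 of its own array. *)
Local Notation iN := 1%N (only parsing).
Local Notation kx := 5%N (only parsing).
Local Notation cnt := 6%N (only parsing).
Local Notation best := 7%N (only parsing).
Local Notation tmp := 0%N (only parsing).
Local Notation eps := 1%N (only parsing).
Local Notation tbest := 2%N (only parsing).
Local Notation prev := 3%N (only parsing).
Local Notation tmp' := 4%N (only parsing).
Local Notation diffs := 3%N (only parsing).
Local Notation axes := 4%N (only parsing).
Local Notation keys := 5%N (only parsing).
Local Notation slopes := 6%N (only parsing).
Local Notation keys' := 7%N (only parsing).
Local Notation slopes' := 8%N (only parsing).
Local Notation cand := 9%N (only parsing).
Local Notation vrow a := (VRow a (ILit 0)).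
Local Notation diff_row k := (VRow diffs (IVar k)).
Local Notation incr a := (ISet a (IAdd (IVar a) (ILit 1))).

Definition sets_vput :=
  (sets_ivar_vput, sets_rvar_vput, sets_iarr_vput, sets_rarr_vput).

Ltac frame := by rewrite /= ?sets_vput ?orbF ?andbF.

Section Programs.
Variable d : nat.

Definition count_wins (a : nat) : cmd :=
  Seq (ISet cnt (ILit 0))
    (For kx (IVar iN)
      (If (BRLe (vdot d (vrow a) (diff_row kx)) (RLit 0)) Skip (incr cnt))).

(** The incumbent is recounted instead of storing its score: one more linear pass, and no score has
    to survive the inner depths. *)
Definition consider (a : nat) : cmd :=
  Seq (count_wins a) (Seq (ISet best (IVar cnt)) (Seq (count_wins cand)
    (If (BILe (IVar best) (IVar cnt)) (vput d a (ILit 0) (vrow cand)) Skip))).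

(* [eps * (1 + x ^ 2) <= <u, z>] with [x = <q, z>] is enough for
   [0 < <u + eps q, z>], since [- x < 1 + x ^ 2]. *)
Definition find_step (u q : nat) : cmd :=
  Seq (RSet eps (RLit 1))
    (For kx (IVar iN)
      (Seq (RSet tmp (vdot d (vrow u) (diff_row kx)))
      (Seq (RSet tmp' (vdot d (vrow q) (diff_row kx)))
      (Seq (RSet tmp' (RDiv (RVar tmp)
         (RAdd (RLit 1) (RMul (RVar tmp') (RVar tmp')))))
      (If (BRLe (RVar tmp) (RLit 0)) Skip
        (If (BRLe (RVar eps) (RVar tmp')) Skip (RSet eps (RVar tmp')))))))).

Fixpoint project (q : nat) (qa : seq nat) (src : vexp) : cmd :=
  match qa with
  | [::] => vput d q (ILit 0) src
  | a :: qa' =>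
    Seq (project q qa' src)
    (Seq (RSet tmp (RSub (RLit 0)
       (RDiv (vdot d (vrow a) (vrow q)) (vdot d (vrow a) (vrow a)))))
    (vput d q (ILit 0) (VAxpy (vrow q) tmp (vrow a))))
  end.

Variable R : realType.
Implicit Types s : state R.

Definition ctx (N : nat) (Z : nat -> 'cV[R]_d) s :=
  [/\ ivar s iN = N,
      forall k, (k < N)%N -> vec d (rarr s) diffs k = Z k &
      forall c, (c < d + d)%N -> vec d (rarr s) axes c = axis_dir R d c].

Lemma ctx_keeps N Z c s s' : keeps c s s' ->
  ~~ sets_ivar c iN -> ~~ sets_rarr c diffs -> ~~ sets_rarr c axes ->
  ctx N Z s -> ctx N Z s'.
Proof.
move=> k h1 h2 h3 [hN hZ hA]; split; first by rewrite (keeps_ivar k).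
  by move=> i /hZ <-; apply: vec_keeps h2.
by move=> i /hA <-; apply: vec_keeps h3.
Qed.

Lemma cost_linear n a b c : (c + (n * a + b) <= (a + b + c) * n.+1)%N.
Proof. by rewrite mulnS mulnC; nia. Qed.

Lemma cost_linear2 n a b c e :
  (c + (n * a + b + e) <= (a + b + c + e) * n.+1)%N.
Proof. by rewrite mulnS mulnC; nia. Qed.

Lemma count_wins_run a : exists K, forall N Z s, ctx N Z s ->
  run (count_wins a) s (K * N.+1)
    (fun s' => ivar s' cnt = wins N Z (vec d (rarr s) a 0)).
Proof.
(* The constant stays open until [cost_linear] reads it off the cost of the loop body. *)
eexists => N Z s cs.
apply: (run_seq (T1 := 2) (Q1 := fun s' => ivar s' cnt = 0%N)).
- by apply: run_sem.
- move=> s1 k1 c1.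
  apply: (run_for (n := N)
    (I := fun j s' => ivar s' cnt = (\sum_(k < j) (0%R < dot (vec d (rarr s) a
      0) (Z k))%R)%N)).
  + frame.
  + by move=> s' k2 /=; rewrite (keeps_ivar k2) // (keeps_ivar k1) //; case: cs.
  + by rewrite big_ord0.
  + move=> j s' k2 jN kj Ij; apply: run_sem; [done|exact: leqnn|move=> _ _].
    have cs' : ctx N Z s' by apply: (ctx_keeps k2) => //; apply: (ctx_keeps k1).
    have wa : vec d (rarr s') a 0 = vec d (rarr s) a 0.
      by rewrite (vec_keeps _ _ k2) // (vec_keeps _ _ k1).
    have zj : vec d (rarr s') diffs j = Z j by case: cs' => _ ->.
    rewrite /= reval_vdot !vevalE /= kj wa zj big_ord_recr /= -Ij.
    by case: ltrP => _ /=; rewrite ?addn0.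
  + by move=> s' _ ->.
  exact: leqnn.
- exact: cost_linear.
Qed.

Lemma consider_run a : a != cand -> (4 < a)%N ->
  exists K, forall N Z s, ctx N Z s ->
  run (consider a) s (K * N.+1) (fun s' =>
    let u := vec d (rarr s) a 0 in let v := vec d (rarr s) cand 0 in
    let w := vec d (rarr s') a 0 in
    [/\ w = u \/ w = v, (wins N Z u <= wins N Z w)%N
      & (wins N Z v <= wins N Z w)%N]).
Proof.
move=> ac a4; have [K1 h1] := count_wins_run a.
have [K2 h2] := count_wins_run cand.
exists (K1 + K2 + (2 + cmd_cost (If (BILe (IVar best) (IVar cnt)) (vput d a
  (ILit 0) (vrow cand)) Skip)))%N.
move=> N Z s cs.
apply: run_seq (h1 N Z s cs) _ _ => [s1 k1 c1|].
have cs1 : ctx N Z s1 by apply: (ctx_keeps k1).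
apply: (run_seq (T1 := 2) (Q1 := fun s' =>
  s' = sem (ISet best (IVar cnt)) s1)) => [|s2 k2 e2|].
- by apply: run_sem.
- have cs2 : ctx N Z s2 by apply: (ctx_keeps k2).
  apply: run_seq (h2 N Z s2 cs2) _ _ => [s3 k3 c3|].
  + apply: run_sem; [|exact: leqnn|move=> k4].
      by rewrite /= loopfree_vput.
    have v3 b : vec d (rarr s3) b 0 = vec d (rarr s) b 0.
      by rewrite (vec_keeps _ _ k3) // (vec_keeps _ _ k2) // (vec_keeps _ _ k1).
    have c2 : vec d (rarr s2) cand 0 = vec d (rarr s) cand 0.
      by rewrite (vec_keeps _ _ k2) // (vec_keeps _ _ k1).
    have b3 : ivar s3 best = wins N Z (vec d (rarr s) a 0).
      by rewrite (keeps_ivar k3) // e2 /= /upd eqxx c1.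
    rewrite [sem _ _]/= b3 c3 c2; case: leqP => le /=.
      rewrite vec_vput /= !eqxx vevalE /= v3; split => //; by right.
    by rewrite v3; split => //; [left|exact: ltnW].
  exact: leqnn.
- exact: leqnn.
rewrite !mulnDl -addnA leq_add2l addnCA leq_add2l.
nia.
Qed.

Lemma find_step_run u q : exists K, forall N Z s, ctx N Z s ->
  run (find_step u q) s (K * N.+1) (fun s' =>
    safe_step N Z (vec d (rarr s) u 0) (vec d (rarr s) q 0) (rvar s' eps)).
Proof.
eexists => N Z s cs.
apply: (run_seq (T1 := 2) (Q1 := fun s' => rvar s' eps = 1)).
- by apply: run_sem.
- move=> s1 k1 c1.
  apply: (run_for (n := N) (I := fun j s' => 0 < rvar s' eps /\
    forall k, (k < j)%N -> 0 < dot (vec d (rarr s) u 0) (Z k) ->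
      rvar s' eps * (1 + dot (vec d (rarr s) q 0) (Z k) ^+ 2) <=
      dot (vec d (rarr s) u 0) (Z k))).
  + by [].
  + by move=> s' k2 /=; rewrite (keeps_ivar k2) // (keeps_ivar k1) //; case: cs.
  + by rewrite /= c1.
  + move=> j s' k2 jN kj [e0 Ij]; apply: run_sem;
      [done|exact: leqnn|move=> _ _].
    have cs' : ctx N Z s' by apply: (ctx_keeps k2) => //; apply: (ctx_keeps k1).
    have wE a : vec d (rarr s') a 0 = vec d (rarr s) a 0.
      by rewrite (vec_keeps _ _ k2) // (vec_keeps _ _ k1).
    have zj : vec d (rarr s') diffs j = Z j by case: cs' => _ ->.
    rewrite /= !reval_vdot !vevalE /= kj !wE zj /upd /= -expr2.
    set x := dot _ (Z j); set y := dot _ (Z j).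
    have y0 : 0 < 1 + y ^+ 2 by rewrite ltr_wpDr ?sqr_ge0.
    have [x0|x0] := lerP x 0.
      split => //= k; rewrite ltnS leq_eqVlt => /orP[/eqP->|]; last exact: Ij.
      by rewrite ltNge x0.
    have [le|lt] := lerP (rvar s' eps) (x / (1 + y ^+ 2)).
      split => //= k; rewrite ltnS leq_eqVlt => /orP[/eqP->|]; last exact: Ij.
      by rewrite -ler_pdivlMr.
    split; rewrite /= /upd /=; first exact: divr_gt0.
    move=> k; rewrite ltnS leq_eqVlt => /orP[/eqP->|kj'].
      by rewrite divfK ?lt0r_neq0.
    move=> /(Ij k kj'); apply: le_trans.
    by rewrite ler_wpM2r ?(ltW lt) // addr_ge0 ?sqr_ge0.
  + move=> s' _ [e0 h]; split => // k kN uk; have := h k kN uk.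
    rewrite !dotL; move: (rvar s' eps) (dot _ (Z k)) e0 => e x e0 le.
    have : 0 < e * (1 + x + x ^+ 2) by rewrite mulr_gt0 //; nra.
    by move: le; lra.
  exact: leqnn.
- exact: cost_linear.
Qed.

Lemma loopfree_project q qa src : loopfree (project q qa src).
Proof. by elim: qa => [|a qa IH] /=; rewrite ?IH loopfree_vput. Qed.

Lemma sem_project q qa src s : q \notin qa ->
  let s' := sem (project q qa src) s in
  [/\ vec d (rarr s') q 0 =
        proj [seq vec d (rarr s) a 0 | a <- qa] (veval d s src),
      ivar s' = ivar s
    & forall a k, a != q -> vec d (rarr s') a k = vec d (rarr s) a k].
Proof.
elim: qa => [_|a qa IH] /=.
  rewrite vec_vput /= !eqxx ivar_vput; split => // a k aq.
  by rewrite vec_vput (negbTE aq).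
rewrite inE negb_or => /andP[qa_ /IH[v1 i1 h1]].
rewrite vec_vput ivar_vput /= !eqxx; split => // [|b k bq].
  rewrite !vevalE /= /upd eqxx !reval_vdot !vevalE /=.
  rewrite v1 !h1 1?eq_sym // sub0r -scaleNr //.
by rewrite vec_vput (negbTE bq) /= h1.
Qed.

Definition pairs (m : nat -> nat -> R) (ka sa n : nat) : seq (R * R) :=
  [seq (m ka k, m sa k) | k <- iota 0 n].

Lemma size_pairs m ka sa n : size (pairs m ka sa n) = n.
Proof. by rewrite size_map size_iota. Qed.

Lemma nth_pairs m ka sa n k : (k < n)%N ->
  nth (0, 0) (pairs m ka sa n) k = (m ka k, m sa k).
Proof. by move=> kn; rewrite (nth_map 0%N) ?size_iota // nth_iota. Qed.

Lemma eq_pairs m m' ka sa ka' sa' n :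
  (forall k, (k < n)%N -> m ka k = m' ka' k /\ m sa k = m' sa' k) ->
  pairs m ka sa n = pairs m' ka' sa' n.
Proof.
move=> h; apply/eq_in_map => k; rewrite mem_iota add0n => /andP[_ kn].
by have [-> ->] := h k kn.
Qed.

Lemma pairsS m ka sa n :
  pairs m ka sa n.+1 = rcons (pairs m ka sa n) (m ka n, m sa n).
Proof. by rewrite /pairs -[n.+1]addn1 iotaD map_cat /= cats1. Qed.

End Programs.

(** * Line search: sorting and sweeping the breakpoints *)

Definition fill d (a b : nat) : cmd :=
  For kx (IVar iN)
    (Seq (RSet tmp (vdot d (vrow b) (diff_row kx)))
    (Seq (RPut keys (IVar kx)
       (RDiv (RSub (RLit 0) (vdot d (vrow a) (diff_row kx))) (RVar tmp)))
    (RPut slopes (IVar kx) (RVar tmp)))).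

(** Truncated subtraction makes this the minimum of [e] and [N]. *)
Definition capped e := ISub e (ISub e (IVar iN)).

Definition take_from (j : nat) : cmd :=
  Seq (RPut keys' (IVar 9) (RGet keys (IVar j)))
  (Seq (RPut slopes' (IVar 9) (RGet slopes (IVar j))) (incr j)).

(* Integer variable 8 is the width of the runs, 9 the number of pairs emitted;
   the runs being merged are [10..12) and [11..13). *)
Definition next_runs : cmd :=
  If (BILe (IVar 13) (IVar 9))
    (Seq (ISet 10 (IVar 9))
    (Seq (ISet 12 (capped (IAdd (IVar 9) (IVar 8))))
    (Seq (ISet 11 (IVar 12))
    (ISet 13 (capped (IAdd (IVar 12) (IVar 8)))))))
    Skip.

Definition take_next : cmd :=
  If (BILe (IVar 12) (IVar 10)) (take_from 11)
    (If (BILe (IVar 13) (IVar 11)) (take_from 10)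
      (If (BRLe (RGet keys (IVar 10)) (RGet keys (IVar 11)))
        (take_from 10) (take_from 11))).

(** Each iteration emits exactly one pair, so the loop counter is the output index and the linear
    cost needs no amortisation over runs. *)
Definition merge_runs : cmd :=
  Seq (Seq (ISet 10 (ILit 0)) (Seq (ISet 11 (ILit 0))
        (Seq (ISet 12 (ILit 0)) (ISet 13 (ILit 0)))))
  (For 9 (IVar iN) (Seq next_runs take_next)).

Definition copy_back : cmd :=
  For kx (IVar iN)
    (Seq (RPut keys (IVar kx) (RGet keys' (IVar kx)))
         (RPut slopes (IVar kx) (RGet slopes' (IVar kx)))).

Definition sort_pairs : cmd :=
  Seq (ISet 8 (ILit 1))
  (While (BNot (BILe (IVar iN) (IVar 8)))
    (Seq merge_runs (Seq copy_back (ISet 8 (IAdd (IVar 8) (IVar 8)))))).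

Section Sorting.
Variables (R : realType) (d : nat).
Implicit Types s : state R.

Lemma fill_run a b : exists K, forall N (Z : nat -> 'cV[R]_d) s, ctx N Z s ->
  (8 < a)%N -> (8 < b)%N ->
  run (fill d a b) s (K * N.+1) (fun s' =>
    pairs (rarr s') keys slopes N =
    breakpoints N Z (vec d (rarr s) a 0) (vec d (rarr s) b 0)).
Proof.
eexists => N Z s cs a8 b8.
apply: (run_for (n := N) (I := fun j s' => forall k, (k < j)%N ->
  (rarr s' keys k, rarr s' slopes k) =
  ((0 - dot (vec d (rarr s) a 0) (Z k)) / dot (vec d (rarr s) b 0) (Z k),
   dot (vec d (rarr s) b 0) (Z k)))).
- by [].
- by move=> s' k2 /=; rewrite (keeps_ivar k2) //; case: cs.
- by [].
- move=> j s' k2 jN kj Ij; apply: run_sem; [done|exact: leqnn|move=> _ _].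
  have cs' : ctx N Z s' by apply: (ctx_keeps k2).
  have zj : vec d (rarr s') diffs j = Z j by case: cs' => _ ->.
  have wE c : (8 < c)%N -> vec d (rarr s') c 0 = vec d (rarr s) c 0.
    by move=> c8; rewrite (vec_keeps _ _ k2) //=; do 8?case: c c8 => [|c] c8.
  move=> k; rewrite ltnS /= /upd2 /upd /= kj !reval_vdot !vevalE /= kj !wE //
    zj.
  by have [->//|nkj] := eqVneq k j; rewrite leq_eqVlt (negbTE nkj) => /Ij.
- move=> s' _ h; apply/eq_in_map => k; rewrite mem_iota add0n => /andP[_ kN].
  exact: h.
- exact: (cost_linear _ _ _ 0).
Qed.

Lemma sem_take_from s p N : (ivar s p < N)%N ->
  let s' := sem (take_from p) s in
  [/\ pairs (rarr s') keys' slopes' (ivar s 9).+1 =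
        rcons (pairs (rarr s) keys' slopes' (ivar s 9))
          (nth (0, 0) (pairs (rarr s) keys slopes N) (ivar s p)),
      ivar s' p = (ivar s p).+1
    & forall q, q != p -> ivar s' q = ivar s q].
Proof.
move=> pN; rewrite /= nth_pairs // pairsS; split => [||q qp].
- congr rcons; last by rewrite /= /upd2 /upd /= !eqxx.
  by apply: eq_pairs => k; rewrite /= /upd2 /upd /= => /ltn_eqF->.
- by rewrite /upd eqxx addn1.
- by rewrite /upd (negbTE qp).
Qed.

Lemma merge_runs_run : exists K, forall N s,
  ivar s iN = N -> (0 < ivar s 8)%N ->
  run merge_runs s (K * N.+1) (fun s' =>
    pairs (rarr s') keys' slopes' N =
    merge_pass (@key_le R) (ivar s 8) (pairs (rarr s) keys slopes N)).
Proof.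
eexists => N s sN w0; set S := pairs _ _ _ _; set w := ivar s 8 in w0 *.
apply: (run_seq (T1 := 8) (Q1 := fun s' =>
  [/\ ivar s' 10 = 0, ivar s' 11 = 0, ivar s' 12 = 0 & ivar s' 13 = 0]%N)).
- by apply: run_sem.
- move=> s1 k1 [i10 i11 i12 i13].
  apply: (run_for (n := N) (I := fun j s' =>
    merging (@key_le R) w S (pairs (rarr s') keys' slopes' j)
      (ivar s' 10) (ivar s' 11) (ivar s' 12) (ivar s' 13))).
  + by [].
  + by move=> s' k2 /=; rewrite (keeps_ivar k2) // (keeps_ivar k1).
  + rewrite /= /upd /= i10 i11 i12 i13; exact: merging0.
  + move=> j s' k2 jN kj Ij; apply: run_sem; [done|exact: leqnn|move=> _ _].
    have sN' : ivar s' iN = N by rewrite (keeps_ivar k2) // (keeps_ivar k1).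
    have sw : ivar s' 8 = w by rewrite (keeps_ivar k2) // (keeps_ivar k1).
    have S' : pairs (rarr s') keys slopes N = S.
      by apply: eq_pairs => k _; rewrite !(keeps_rarr k2) // !(keeps_rarr k1).
    set s2 := sem next_runs s'.
    have [I2 lt2] : merging (@key_le R) w S (pairs (rarr s') keys' slopes' j)
        (ivar s2 10) (ivar s2 11) (ivar s2 12) (ivar s2 13) /\
        (j < ivar s2 13)%N.
      rewrite /s2 [sem _ _]/= kj; case: (leqP (ivar s' 13) j) => h;
        last by split.
      rewrite /= /upd /= kj sN' sw.
      have := merging_next w0 Ij; rewrite !size_pairs => /(_ h jN).
      by rewrite -!minnE.
    have [r2 i2 i9] : [/\ rarr s2 = rarr s', ivar s2 iN = N & ivar s2 9 = j].
      by rewrite /s2 [sem _ _]/=; case: ifP.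
    change (sem (Seq _ _) s') with (sem take_next s2); clearbody s2.
    have [_ im jh sz] := I2; rewrite !size_pairs in jh sz.
    have R2 : pairs (rarr s2) keys slopes N = S by rewrite r2.
    have left : (ivar s2 10 < ivar s2 12)%N ->
        (ivar s2 13 <= ivar s2 11)%N ||
        key_le (nth (0, 0) S (ivar s2 10)) (nth (0, 0) S (ivar s2 11)) ->
        let s3 := iset (sem (take_from 10) s2) 9 j.+1 in
        merging (@key_le R) w S (pairs (rarr s3) keys' slopes' j.+1)
        (ivar s3 10) (ivar s3 11) (ivar s3 12) (ivar s3 13).
      move=> h1 h2; cbv zeta; have lN : (ivar s2 10 < N)%N by lia.
      have := sem_take_from lN; cbv zeta.
      case=> pE lE oE.
      rewrite i9 R2 r2 in pE; set s3 := sem _ _ in pE lE oE *; clearbody s3.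
      rewrite /= /upd /= [ivar s3 10]lE !oE // pE.
      exact: merging_left I2 h1 h2.
    have right : (ivar s2 11 < ivar s2 13)%N ->
        (ivar s2 12 <= ivar s2 10)%N ||
        ~~ key_le (nth (0, 0) S (ivar s2 10)) (nth (0, 0) S (ivar s2 11)) ->
        let s3 := iset (sem (take_from 11) s2) 9 j.+1 in
        merging (@key_le R) w S (pairs (rarr s3) keys' slopes' j.+1)
        (ivar s3 10) (ivar s3 11) (ivar s3 12) (ivar s3 13).
      move=> h1 h2; cbv zeta; have lN : (ivar s2 11 < N)%N by lia.
      have := sem_take_from lN; cbv zeta.
      case=> pE lE oE.
      rewrite i9 R2 r2 in pE; set s3 := sem _ _ in pE lE oE *; clearbody s3.
      rewrite /= /upd /= [ivar s3 11]lE !oE // pE.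
      exact: merging_right I2 h1 h2.
    have kE : (ivar s2 10 < N)%N -> (ivar s2 11 < N)%N ->
       (rarr s2 keys (ivar s2 10) <= rarr s2 keys (ivar s2 11)) =
       key_le (nth (0, 0) S (ivar s2 10)) (nth (0, 0) S (ivar s2 11)).
      by move=> h1 h2; rewrite -R2 !nth_pairs.
    rewrite (_ : sem take_next s2 =
      if (ivar s2 12 <= ivar s2 10)%N then sem (take_from 11) s2 else
      if (ivar s2 13 <= ivar s2 11)%N then sem (take_from 10) s2 else
      if rarr s2 keys (ivar s2 10) <= rarr s2 keys (ivar s2 11)
      then sem (take_from 10) s2 else sem (take_from 11) s2) //.
    have [h1|h1] := leqP (ivar s2 12) (ivar s2 10).
      by apply: right; [lia|rewrite h1].
    have [h2|h2] := leqP (ivar s2 13) (ivar s2 11).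
      by apply: left; rewrite ?h2.
    rewrite kE; try lia; case: ifP => h.
      by apply: left; rewrite ?h ?orbT.
    by apply: right; rewrite ?h ?orbT.
  + move=> s' _ h; apply: merging_done h _; by rewrite !size_pairs.
  exact: leqnn.
- exact: cost_linear.
Qed.

Lemma copy_back_run : exists K, forall N s, ivar s iN = N ->
  run copy_back s (K * N.+1) (fun s' =>
    pairs (rarr s') keys slopes N = pairs (rarr s) keys' slopes' N).
Proof.
eexists => N s sN.
apply: (run_for (n := N) (I := fun j s' => forall k, (k < j)%N ->
  rarr s' keys k = rarr s keys' k /\ rarr s' slopes k = rarr s slopes' k)).
- by [].
- by move=> s' k2 /=; rewrite (keeps_ivar k2).
- by [].
- move=> j s' k2 jN kj Ij; apply: run_sem; [done|exact: leqnn|move=> _ _].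
  move=> k; rewrite ltnS /= /upd2 /upd /= kj.
  rewrite (keeps_rarr k2 (a := keys')) // (keeps_rarr k2 (a := slopes')) //.
  have [->|nkj] := eqVneq k j; first by split.
  by rewrite leq_eqVlt (negbTE nkj) => /Ij.
- by move=> s' _ h; apply: eq_pairs.
- exact: (cost_linear _ _ _ 0).
Qed.

Lemma sort_pairs_run : exists K, forall N s, ivar s iN = N ->
  run sort_pairs s (K * (N.+1 * (up_log 2 N).+1)) (fun s' =>
    let S := pairs (rarr s') keys slopes N in
    sorted (@key_le R) S /\ perm_eq S (pairs (rarr s) keys slopes N)).
Proof.
have [K1 h1] := merge_runs_run; have [K2 h2] := copy_back_run.
(* The 4 pays for doubling the width, each 6 covers a guard evaluation, inside the loop and at its
   exit, and the 2 is the initialisation. *)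
exists (K1 + K2 + 4 + 6 + 6 + 2)%N => N s sN.
pose L := up_log 2 N.
apply: (run_seq (T1 := 2) (Q1 := fun s' => ivar s' 8 = 1%N)).
- by apply: run_sem.
- move=> s1 k1 w1.
  apply: (run_while (m := L) (T := ((K1 + K2 + 4) * N.+1)%N) (I := fun j s' =>
    let S := pairs (rarr s') keys slopes N in
    exists k, [/\ ivar s' 8 = 2 ^ k, (k + j)%N = L,
      sorted_runs (@key_le R) (2 ^ k) S
      & perm_eq S (pairs (rarr s) keys slopes N)])%N).
  + exists 0%N; split; rewrite ?expn0 //; first exact: sorted_runs1.
    rewrite (_ : pairs _ _ _ _ = pairs (rarr s) keys slopes N) //.
    by apply: eq_pairs => i _; rewrite !(keeps_rarr k1).
  + move=> j s' k2 [k [w' kj sr pS]] /=.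
    have sN' : ivar s' iN = N by rewrite (keeps_ivar k2) // (keeps_ivar k1).
    rewrite sN' w' -ltnNge => lt.
    (* A width [2 ^ k] below [N] leaves a pass to spend, because [N <= 2 ^ L]. *)
    have kL : (k < L)%N.
      rewrite ltnNge; apply: contraL lt => Lk; rewrite -leqNgt.
      apply: leq_trans (up_logP N (isT : 1 < 2)%N) _.
      by rewrite leq_exp2l.
    split; first by lia.
    apply: run_seq (h1 N s' sN' _) _ _ => [|s2 k3 e3|].
    * by rewrite w' expn_gt0.
    * have sN2 : ivar s2 iN = N by rewrite (keeps_ivar k3).
      apply: run_seq (h2 N s2 sN2) _ (leqnn _) => s3 k4 e4.
      apply: (run_sem (T := 4)) => // _; exists k.+1.
      have w3 : ivar s3 8 = (2 ^ k)%N by rewrite (keeps_ivar k4) //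
        (keeps_ivar k3).
      rewrite /= /upd /= w3 e4 e3 w' expnS mul2n addnn; split => //.
      - by lia.
      - by rewrite -addnn; apply: sorted_runs_merge_pass => //;
          [exact: key_le_total|rewrite expn_gt0].
      - apply: perm_trans pS; apply: perm_merge_pass.
        by rewrite expn_gt0.
    * by rewrite !mulnDl; lia.
  + move=> j s' k2 [k [w' kj sr pS]] /=.
    have sN' : ivar s' iN = N by rewrite (keeps_ivar k2) // (keeps_ivar k1).
    rewrite sN' w' negbK => le; split => //.
    by apply: sorted_runs_full sr; rewrite size_pairs.
  exact: leqnn.
- rewrite -/L [bcost _]/=; move: L => L.
  by rewrite mulnS mulnDr; nia.
Qed.

End Sorting.

(** Decisions are taken only where the key strictly increases: inside a group of equal keys the
    running count belongs to no [t]. *)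
Definition sweep_step : cmd :=
  Seq (If (BRLe (RGet keys (IVar kx)) (RVar prev)) Skip
        (If (BILe (IVar best) (IVar cnt))
          (Seq (ISet best (IVar cnt))
            (RSet tbest
              (RDiv (RAdd (RVar prev) (RGet keys (IVar kx))) (RLit 2))))
          Skip))
  (Seq (RSet prev (RGet keys (IVar kx)))
    (If (BRLe (RGet slopes (IVar kx)) (RLit 0))
      (If (BRLe (RLit 0) (RGet slopes (IVar kx))) Skip
        (ISet cnt (ISub (IVar cnt) (ILit 1))))
      (incr cnt))).

(* The counter starts at the number of pairs rather than at [nneg_key], so that
   no preliminary count is needed; only comparisons between values matter. *)
Definition sweep : cmd :=
  Seq (Seq (ISet cnt (IVar iN)) (Seq (ISet best (ILit 0))
        (RSet prev (RSub (RGet keys (ILit 0)) (RLit 2)))))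
  (Seq (For kx (IVar iN) sweep_step)
    (If (BILe (IVar best) (IVar cnt))
      (RSet tbest (RAdd (RVar prev) (RLit 1))) Skip)).

Definition line_search d (a b w : nat) : cmd :=
  Seq (fill d a b) (Seq sort_pairs (Seq sweep
    (vput d w (ILit 0) (VAxpy (vrow a) tbest (vrow b))))).

Section Sweeping.
Variables (R : realType) (d : nat).
Implicit Types s : state R.

Lemma sweep_run : exists K, forall N s, ivar s iN = N ->
  let S := pairs (rarr s) keys slopes N in
  sorted (@key_le R) S ->
  run sweep s (K * N.+1) (fun s' => exists i,
    [/\ (i <= N)%N, separates S i (rvar s' tbest) &
    forall j, (j <= N)%N -> gap S j ->
    (npos_key (take j S) + nneg_key (take i S) <=
     npos_key (take i S) + nneg_key (take j S))%N]).
Proof.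
eexists => N s sN S sS.
pose P j := npos_key (take j S); pose M j := nneg_key (take j S).
have szS : size S = N by rewrite size_pairs.
(* The value of [prev] before index [j]. The fictitious key 2 below the first one makes position 0
   pass the test for a gap and puts its midpoint 1 below all keys. *)
pose p j := if j is j'.+1 then rarr s keys j' else rarr s keys 0%N - 2%:R.
have nthS k : (k < N)%N -> nth (0, 0) S k = (rarr s keys k, rarr s slopes k).
  exact: nth_pairs.
(* Since the counter starts at [N], this keeps its truncated decrement exact. *)
have M_le j : (M j <= j)%N.
  by apply: leq_trans (count_size _ _) _; rewrite size_take_min geq_minl.
have takeS (q : pred (R * R)) j : (j < N)%N ->
    count q (take j.+1 S) = (count q (take j S) + q (nth (0%R, 0%R) S j))%N.
  by move=> jN; rewrite (take_nth (0, 0)) ?szS // -cats1 count_cat /= addn0.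
apply: (run_seq (T1 := cmd_cost (Seq (ISet cnt (IVar iN)) (Seq (ISet best
  (ILit 0))
        (RSet prev (RSub (RGet keys (ILit 0)) (RLit 2)))))) (Q1 := fun s' =>
  [/\ ivar s' cnt = N, ivar s' best = 0%N & rvar s' prev = p 0%N])).
- by apply: run_sem => // _; rewrite /= /upd /= sN.
- move=> s1 k1 [c1 b1 p1].
  (* [best] is the largest count over the gaps seen, attained at the cut realised by [tbest]. The
     clause for an empty range ensures that the first cut is accepted, before which [tbest] has no
     meaning. *)
  apply: (run_seq (Q1 := fun s' => [/\ (ivar s' cnt + M N = N + P N)%N,
     rvar s' prev = p N,
     ((0 < N)%N -> exists i, [/\ (i < N)%N, separates S i (rvar s' tbest) &
        (ivar s' best + M i = N + P i)%N]),
     (N = 0%N -> ivar s' best = 0%N) &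
     forall i, (i < N)%N -> gap S i -> (N + P i <= ivar s' best + M i)%N])).
  + apply: (run_for (n := N) (I := fun j s' =>
      [/\ (ivar s' cnt + M j = N + P j)%N, rvar s' prev = p j,
     ((0 < j)%N -> exists i, [/\ (i < j)%N, separates S i (rvar s' tbest) &
        (ivar s' best + M i = N + P i)%N]),
     (j = 0%N -> ivar s' best = 0%N) &
     forall i, (i < j)%N -> gap S i -> (N + P i <= ivar s' best + M i)%N])).
    * by [].
    * by move=> s' k2 /=; rewrite (keeps_ivar k2) // (keeps_ivar k1).
    * by rewrite /iset /= /upd /= c1 p1 b1 /M /P take0.
    * move=> j s' k2 jN kj [cE pE bE b0 bmax].
      apply: run_sem; [done|exact: leqnn|move=> _ _].
      have kE : rarr s' keys j = rarr s keys j.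
        by rewrite (keeps_rarr k2) // (keeps_rarr k1).
      have lE : rarr s' slopes j = rarr s slopes j.
        by rewrite (keeps_rarr k2) // (keeps_rarr k1).
      rewrite (_ : sem sweep_step s' =
        sem (Seq (RSet prev (RGet keys (IVar kx)))
    (If (BRLe (RGet slopes (IVar kx)) (RLit 0))
      (If (BRLe (RLit 0) (RGet slopes (IVar kx))) Skip
        (ISet cnt (ISub (IVar cnt) (ILit 1))))
      (incr cnt)))
      (if rarr s' keys (ivar s' kx) <= rvar s' prev then s' else
       if (ivar s' best <= ivar s' cnt)%N then
         sem (Seq (ISet best (IVar cnt)) (RSet tbest
              (RDiv (RAdd (RVar prev) (RGet keys (IVar kx))) (RLit 2)))) s'
       else s')) //.
      set s2 := if _ then s' else _.
      have [c2 r2 k2x] : [/\ ivar s2 cnt = ivar s' cnt,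
        rarr s2 = rarr s' & ivar s2 kx = j].
        by rewrite /s2; case: ifP => // _; case: ifP.
      have [b2 bmax2] : (exists i, [/\ (i < j.+1)%N,
        separates S i (rvar s2 tbest) &
        (ivar s2 best + M i = N + P i)%N]) /\
        (forall i, (i < j.+1)%N -> gap S i -> (N + P i <= ivar s2 best + M
          i)%N).
        have pj : gap S j -> p j < rarr s keys j.
          case: (j) jN => [|j'] jN gj; first by rewrite /= ltrBlDr ltrDl.
          have := gap_lt (0, 0) _ gj; rewrite szS jN => /(_ isT) /=.
          by rewrite !nthS //; apply: ltnW.
        rewrite /s2 kj kE pE; case: ifP => [le|/negbT];
          last rewrite -ltNge => lt.
          case: (posnP j) => [j0|j0].
            by move: le; rewrite j0 /= leNgt ltrBlDr ltrDl ltr0n.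
          split; first by have [i [ij h1 h2]] := bE j0; exists i; split => //;
            apply: ltnW.
          move=> i; rewrite ltnS leq_eqVlt => /orP[/eqP->|]; last exact: bmax.
          by move=> /pj; rewrite ltNge le.
        case: ifP => [ge|/negbT]; last rewrite -ltnNge => lt'.
          rewrite /= /upd /=; split.
            exists j; split => //; rewrite ?kj ?kE ?pE.
              apply: (@separatesI _ (0, 0)) => //; rewrite ?szS ?(ltnW jN) //.
                case: (j) jN lt => //= j' jN lt _; rewrite nthS ?(ltnW jN) //=.
                by rewrite midf_lt.
              by move=> _; rewrite nthS //= midf_lt.
          move=> i; rewrite ltnS leq_eqVlt => /orP[/eqP->|ij gi].
            by rewrite cE.
          by apply: leq_trans (bmax i ij gi) _; rewrite leq_add2r.
        have j0 : (0 < j)%N.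
          by case: posnP => // /b0 bz; rewrite bz in lt'.
        split; first by have [i [ij h1 h2]] := bE j0; exists i; split => //;
          apply: ltnW.
        move=> i; rewrite ltnS leq_eqVlt => /orP[/eqP->|]; last exact: bmax.
        by move=> _; rewrite -cE leq_add2r ltnW.
      clearbody s2.
      have MS : M j.+1 = (M j + (rarr s slopes j < 0)%R)%N.
        by rewrite /M /nneg_key takeS // nthS.
      have PS : P j.+1 = (P j + (0 < rarr s slopes j)%R)%N.
        by rewrite /P /npos_key takeS // nthS.
      rewrite /= k2x r2 kE lE /upd /=; have := M_le j.
      case: ltrgtP MS PS => _ MS PS Mj; rewrite /= ?c2; split => //; lia.
    * by [].
    * exact: leqnn.
  + move=> s2 k2 [cE pE bE b0 bmax]; apply: run_sem;
      [done|exact: leqnn|move=> _].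
    rewrite /=; case: leqP => h /=.
      exists N; split => //; rewrite /upd /=.
        apply: (@separatesI _ (0, 0)) => //; rewrite ?szS // ?ltnn // pE.
        by case: (N) nthS => // N' nthS _; rewrite nthS //= ltrDl.
      rewrite -/(P N) -/(M N) => j; rewrite leq_eqVlt => /orP[/eqP->|jN gj].
        by rewrite -/(P N) -/(M N) addnC.
      have := bmax j jN gj; rewrite -/(P j) -/(M j); lia.
    have N0 : (0 < N)%N by case: posnP => // /b0 bz; rewrite bz in h.
    have [i [iN sep bi]] := bE N0; exists i; split => //; first exact: ltnW.
    move=> j; rewrite leq_eqVlt => /orP[/eqP-> _|jN gj].
      by rewrite -/(P N) -/(M N) -/(P i) -/(M i); lia.
    by have := bmax j jN gj; rewrite -/(P j) -/(M j) -/(P i) -/(M i); lia.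
  exact: leqnn.
- exact: cost_linear2.
Qed.

Lemma line_search_run a b w : exists K, forall N (Z : nat -> 'cV[R]_d) s,
  ctx N Z s -> (9 < a)%N -> (9 < b)%N ->
  run (line_search d a b w) s (K * (N.+1 * (up_log 2 N).+1)) (fun s' =>
    let u := vec d (rarr s) a 0 in let v := vec d (rarr s) b 0 in
    let x := vec d (rarr s') w 0 in
    (exists t, x = u + t *: v) /\
    forall t, (wins N Z (u + t *: v) <= wins N Z x)%N).
Proof.
have [K1 h1] := fill_run R d a b; have [K2 h2] := @sort_pairs_run R.
have [K3 h3] := sweep_run.
exists (K1 + K2 + K3 + cmd_cost (vput d w (ILit 0) (VAxpy (vrow a) tbest (vrow
  b))))%N.
move=> N Z s cs a9 b9.
have ab9 c : (9 < c)%N -> [&& c != keys, c != slopes,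
  c != keys' & c != slopes'].
  by do 9?case: c => [|c] //.
have [sN _ _] := cs.
apply: run_seq (h1 N Z s cs (ltnW a9) (ltnW b9)) _ _ => [s1 k1 p1|].
  have s1N : ivar s1 iN = N by rewrite (keeps_ivar k1).
  apply: run_seq (h2 N s1 s1N) _ (leqnn _) => s2 k2 [so pe].
  have s2N : ivar s2 iN = N by rewrite (keeps_ivar k2).
  apply: run_seq (h3 N s2 s2N so) _ (leqnn _) => s3 k3 [i [iN' sep bst]].
  apply: run_sem; [exact: loopfree_vput|exact: leqnn|move=> _].
  have vE c : (9 < c)%N -> vec d (rarr s3) c 0 = vec d (rarr s) c 0.
    move=> /ab9/and4P[c1 c2 c3 c4]; rewrite (vec_keeps _ _ k3) //.
    rewrite (vec_keeps _ _ k2) ?(vec_keeps _ _ k1) //=.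
      by rewrite !negb_or c1 c2.
    by rewrite !negb_or c1 c2 c3 c4.
  rewrite vec_vput !eqxx !vevalE /= !vE //; split;
    first by exists (rvar s3 tbest).
  apply: line_optimum so sep _; first by rewrite -p1.
  by rewrite size_pairs.
move: (cmd_cost _) => c; rewrite !mulnDl; nia.
Qed.
End Sweeping.

(* At depth [m] the program uses the real arrays [dir m] and [bst m] and the
   integer variable [lev m]; everything used at smaller depths has a smaller
   number. *)
Definition dir (m : nat) : nat := (20 + (m + m))%N.
Definition bst (m : nat) : nat := (19 + (m + m))%N.
Definition lev (m : nat) : nat := (20 + m)%N.

Definition level_src (m : nat) : vexp :=
  VRow (if (m < 2)%N then axes else diffs) (IVar (lev m)).

Definition level_bound (d m : nat) : iexp :=
  if (m < 2)%N then ILit (d + d) else IVar iN.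

(** The incumbent starts at 0, which lies in every subspace, as [level_best_perp] requires of
    whatever survives the loop. *)
Fixpoint solve (d m : nat) (qa : seq nat) : cmd :=
  match m with
  | 0 => if qa is b :: a :: _ then line_search d a b (bst 0) else Skip
  | m'.+1 =>
    Seq (vput d (bst m'.+1) (ILit 0) VZero)
    (For (lev m') (level_bound d m')
      (Seq (project d (dir m') qa (level_src m'))
      (Seq (solve d m' (dir m' :: qa))
      (Seq (find_step d (bst m') (dir m'))
      (Seq (vput d cand (ILit 0) (VAxpy (vrow (bst m')) eps (vrow (dir m'))))
      (consider d (bst m'.+1)))))))
  end.

Lemma sets_ivar_project d q qa src a : sets_ivar (project d q qa src) a = false.
Proof. by elim: qa => [|b qa IH] /=; rewrite ?IH sets_vput. Qed.

Lemma sets_rarr_project d q qa src a : sets_rarr (project d q qa src) a -> a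
  == q.
Proof.
elim: qa => [|b qa IH] /=; rewrite sets_vput; first by case/andP.
by move=> /orP[/IH//|/andP[]].
Qed.

Lemma sets_ivar_solve d m qa a :
  sets_ivar (solve d m qa) a -> (5 <= a <= 13)%N || (20 <= a < 20 + m)%N.
Proof.
elim: m qa => [|m IH] qa.
  case: qa => [|b [|c qa]] //=; rewrite sets_vput; lia.
rewrite [solve _ _ _]/= [sets_ivar _ a]/= !sets_vput sets_ivar_project.
have := IH (dir m :: qa); rewrite /lev.
by case: (sets_ivar (solve _ _ _) a) => [/(_ isT)|_]; lia.
Qed.

Lemma sets_rarr_solve d m qa a :
  sets_rarr (solve d m qa) a -> (5 <= a <= 9)%N || (19 <= a < 20 + (m + m))%N.
Proof.
elim: m qa => [|m IH] qa.
  by case: qa => [|b [|c qa]] //=; rewrite sets_vput /bst; lia.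
rewrite [solve _ _ _]/= [sets_rarr _ a]/= !sets_vput.
have := @sets_rarr_project d (dir m) qa (level_src m) a.
case: (sets_rarr (project _ _ _ _) a) => [/(_ isT)|_]; first by rewrite /dir;
  lia.
have := IH (dir m :: qa); rewrite /dir /bst.
by case: (sets_rarr (solve _ _ _) a) => [/(_ isT)|_]; lia.
Qed.

Section Solving.
Variables (R : realType) (d : nat).
Implicit Types s : state R.

(** Depths 0 to 2 share one unit, since the loops of the two lowest levels have constant length;
    each further depth contributes a factor. The successors keep overheads covered for small [N]. *)
Definition unit_cost (N m : nat) : nat :=
  (N.+1 ^ (m - 2).+1 * (up_log 2 N).+1)%N.

Lemma unit_cost_ge N m : (N.+1 <= unit_cost N m)%N.
Proof.
rewrite /unit_cost -[X in (X <= _)%N]muln1; apply: leq_mul => //.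
by rewrite -{1}[N.+1]expn1 leq_pexp2l.
Qed.

Lemma unit_costS N m : (N * unit_cost N m <= unit_cost N m.+1)%N || (m < 2)%N.
Proof.
rewrite orbC -implyNb -leqNgt; apply/implyP => m2.
rewrite /unit_cost subSn // [X in (_ <= X * _)%N]expnS -mulnA.
by rewrite leq_mul2r leqnSn orbT.
Qed.

Lemma solve_run m qa : all (fun a => 20 + (m + m) <= a)%N qa ->
  exists K, forall N (Z : nat -> 'cV[R]_d) s, ctx N Z s ->
  run (solve d m qa) s (K * unit_cost N m) (fun s' =>
    level_best N Z m [seq vec d (rarr s) a 0 | a <- qa]
      (vec d (rarr s') (bst m) 0)).
Proof.
elim: m qa => [|m IH] qa qa_ge.
  case: qa qa_ge => [|b [|a qa]] /= qa_ge.
  - exists 1%N => N Z s cs; apply: run_sem; [done| |by []].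
    by rewrite mul1n (leq_trans _ (unit_cost_ge _ _)).
  - exists 1%N => N Z s cs; apply: run_sem; [done| |by []].
    by rewrite mul1n (leq_trans _ (unit_cost_ge _ _)).
  have [K h] := line_search_run R d a b (bst 0).
  exists K => N Z s cs; have /and3P[b20 a20 _] := qa_ge.
  apply: run_weaken (h N Z s cs _ _) _ _;
    [lia|lia|by rewrite /unit_cost expn1|].
  by move=> s' _ q a' b' qs' [<- <- _].
have [|K1 h1] := IH (dir m :: qa).
  rewrite /= /dir leqnn /=; apply: sub_all qa_ge => a; lia.
have [K2 h2] := @find_step_run d R (bst m) (dir m).
have [||K3 h3] := @consider_run d R (bst m.+1); [by rewrite /bst; lia..|].
set c4 := cmd_cost (project d (dir m) qa (level_src m)).
set c5 := cmd_cost (vput d cand (ILit 0) (VAxpy (vrow (bst m)) eps (vrow (dir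
  m)))).
set c6 := cmd_cost (vput d (bst m.+1) (ILit 0) VZero).
pose fc := for_cost (level_bound d m).
pose c := (c4 + K1 + K2 + c5 + K3 + fc)%N.
(* [d + d] counts the iterations at the two lowest levels. Elsewhere the [N] iterations are absorbed
   by passing to [unit_cost N m.+1], leaving the coefficient 1. *)
exists ((d + d + 1) * c + fc + c6)%N => N Z s cs.
pose n := if (m < 2)%N then (d + d)%N else N.
pose qs := [seq vec d (rarr s) a 0 | a <- qa].
pose src k := if (m < 2)%N then axis_dir R d k else Z k.
pose good k W0 := exists W' e, let q := proj qs (src k) in
  [/\ level_best N Z m (q :: qs) W', safe_step N Z W' q e & W0 = W' + e *: q].
have q_qa : dir m \notin qa.
  by apply/negP => /(allP qa_ge); rewrite /dir; lia.
have fi a : ~~ ((5 <= a <= 13)%N || (20 <= a < 20 + m.+1)%N) ->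
    ~~ sets_ivar (solve d m.+1 qa) a.
  by apply: contra; apply: sets_ivar_solve.
have fr a : ~~ ((5 <= a <= 9)%N || (19 <= a < 20 + (m.+1 + m.+1))%N) ->
    ~~ sets_rarr (solve d m.+1 qa) a.
  by apply: contra; apply: sets_rarr_solve.
have fi' a : ~~ ((5 <= a <= 13)%N || (20 <= a < 20 + m)%N) ->
    ~~ sets_ivar (solve d m (dir m :: qa)) a.
  by apply: contra; apply: sets_ivar_solve.
have fr' a : ~~ ((5 <= a <= 9)%N || (19 <= a < 20 + (m + m))%N) ->
    ~~ sets_rarr (solve d m (dir m :: qa)) a.
  by apply: contra; apply: sets_rarr_solve.
have fp a : a != dir m -> ~~ sets_rarr (project d (dir m) qa (level_src m)) a.
  by apply: contraNN; apply: sets_rarr_project.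
rewrite [solve _ _ _]/= in fi fr *; set F := For _ _ _ in fi fr *.
apply: (run_seq (T1 := c6) (Q1 := fun s' => vec d (rarr s') (bst m.+1) 0 = 0)).
- by apply: run_sem; rewrite ?loopfree_vput // vec_vput !eqxx veval_zero.
- move=> s1 k1 w1.
  have cs1 : ctx N Z s1 by apply: (ctx_keeps k1) => //;
    rewrite sets_vput // /bst; lia.
  have fiF a : ~~ ((5 <= a <= 13)%N || (20 <= a < 20 + m.+1)%N) -> ~~
    sets_ivar F a.
    by move=> /fi; rewrite [sets_ivar _ _]/= negb_or => /andP[].
  have frF a : ~~ ((5 <= a <= 9)%N || (19 <= a < 20 + (m.+1 + m.+1))%N) -> ~~
    sets_rarr F a.
    by move=> /fr; rewrite [sets_rarr _ _]/= negb_or => /andP[].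
  have csF s' : keeps F s1 s' -> ctx N Z s'.
    by move=> k2; apply: (ctx_keeps k2) cs1;
      [apply: fiF|apply: frF|apply: frF]; lia.
  apply: (run_for (n := n) (I := fun j s' =>
    let W := vec d (rarr s') (bst m.+1) 0 in
    (W = 0 \/ exists k, good k W) /\
    forall k, (k < j)%N -> exists2 W0,
      good k W0 & (wins N Z W0 <= wins N Z W)%N)).
  + rewrite /= !sets_vput sets_ivar_project (negbTE (fi' (lev m) _)) /lev; lia.
  + move=> s' k2; rewrite /level_bound /n; case: ifP => // _.
    by case: (csF s' k2).
  + by rewrite /= w1; split => //; left.
  + move=> j s' k2 jn lj [Wor Wall].
    have cs' := csF s' k2.
    have qs' : [seq vec d (rarr s') a 0 | a <- qa] = qs.
      apply/eq_in_map => a /(allP qa_ge) a_ge.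
      rewrite (vec_keeps _ _ k2) ?(vec_keeps _ _ k1) //.
        by rewrite sets_vput /bst; lia.
      by apply: frF; lia.
    have srcE : veval d s' (level_src m) = src j.
      rewrite /level_src veval_row /= lj /src; case: cs' => _ hZ hA.
      by move: jn; rewrite /n; case: ifP => _ jn; [apply: hA|apply: hZ].
    apply: (run_seq (T1 := c4) (T2 := ((K1 + K2 + c5 + K3) * unit_cost N m)%N)
      (Q1 := fun s2 => [/\ vec d (rarr s2) (dir m) 0 = proj qs (src j),
        ivar s2 = ivar s' & forall a k, a != dir m ->
          vec d (rarr s2) a k = vec d (rarr s') a k])).
    * apply: run_sem; [exact: loopfree_project|exact: leqnn|move=> _].
      by have := @sem_project d R _ _ (level_src m) s' q_qa; rewrite qs' srcE.
    * move=> s2 k3 [q2 i2 v2].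
      have cs2 : ctx N Z s2.
        apply: (ctx_keeps k3) cs'; rewrite ?sets_ivar_project // fp /dir; lia.
      apply: run_seq (h1 N Z s2 cs2) _ _ => [s3 k4 lb|].
        have cs3 : ctx N Z s3.
          by apply: (ctx_keeps k4) cs2; [apply: fi'|apply: fr'|apply: fr']; lia.
        have q3 : vec d (rarr s3) (dir m) 0 = proj qs (src j).
          by rewrite (vec_keeps _ _ k4) ?q2 // fr' // /dir; lia.
        have qs2 : [seq vec d (rarr s2) a 0 | a <- dir m :: qa] =
            proj qs (src j) :: qs.
          rewrite /= q2 -qs'; congr (_ :: _); apply/eq_in_map => a aq.
          by rewrite v2 //; apply: contraNneq q_qa => <-.
        rewrite qs2 in lb.
        apply: run_seq (h2 N Z s3 cs3) _ (leqnn _) => s4 k5 st.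
        rewrite q3 in st.
        apply: (run_seq (T1 := c5) (Q1 := fun s5 =>
            vec d (rarr s5) cand 0 = vec d (rarr s3) (bst m) 0 +
              rvar s4 eps *: proj qs (src j))) _ _ (leqnn _).
          apply: run_sem; [exact: loopfree_vput|exact: leqnn|move=> _].
          rewrite vec_vput !eqxx !vevalE /=.
          by rewrite !(vec_keeps _ _ k5) // q3.
        move=> s5 k6 c5E.
        have cs5 : ctx N Z s5.
          apply: (ctx_keeps k6); rewrite ?sets_vput ?andbF //.
          by apply: (ctx_keeps k5) cs3.
        apply: run_weaken (h3 N Z s5 cs5) (leqnn _) _ => s6 k7.
        rewrite c5E.
        have -> : vec d (rarr s5) (bst m.+1) 0 = vec d (rarr s') (bst m.+1) 0.
          rewrite (vec_keeps _ _ k6); last by rewrite sets_vput /bst; lia.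
          rewrite (vec_keeps _ _ k5) // (vec_keeps _ _ k4) ?v2 //.
            by rewrite /bst /dir; lia.
          by apply: fr'; rewrite /bst; lia.
        case=> Wc leW lec _.
        have gj : good j (vec d (rarr s3) (bst m) 0 +
              rvar s4 eps *: proj qs (src j)).
          by exists (vec d (rarr s3) (bst m) 0), (rvar s4 eps).
        split.
          by case: Wc => ->; [exact: Wor|right; exists j].
        move=> k; rewrite ltnS leq_eqVlt => /orP[/eqP->|kj].
          by exists (vec d (rarr s3) (bst m) 0 + rvar s4 eps *: proj qs (src
            j)).
        have [W0 g0 le0] := Wall k kj; exists W0 => //.
        exact: leq_trans le0 leW.
      have := unit_cost_ge N m; rewrite !mulnDl -!addnA leq_add2l.
      move: (unit_cost N m) => Y hY.
      have e1 : (K2 * N.+1 <= K2 * Y)%N by rewrite leq_mul2l hY orbT.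
      have e2 : (K3 * N.+1 <= K3 * Y)%N by rewrite leq_mul2l hY orbT.
      have e3 : (c5 <= c5 * Y)%N by rewrite leq_pmulr // (leq_trans _ hY).
      by lia.
    * exact: leqnn.
  + by [].
  + exact: leqnn.
- have := unit_cost_ge N m; have := unit_cost_ge N m.+1.
  have := unit_costS N m; rewrite -/fc.
  move=> hS hX hY.
  have body_le : (c4 + (K1 + K2 + c5 + K3) * unit_cost N m + fc <= c *
    unit_cost N m)%N.
    have e1 : (c4 <= c4 * unit_cost N m)%N by rewrite leq_pmulr // (leq_trans
      _ hY).
    have e2 : (fc <= fc * unit_cost N m)%N by rewrite leq_pmulr // (leq_trans
      _ hY).
    by rewrite /c !mulnDl in e1 e2 *; lia.
  have loop_le : (n * (c4 + (K1 + K2 + c5 + K3) * unit_cost N m + fc) <=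
      (d + d + 1) * c * unit_cost N m.+1)%N.
    apply: leq_trans (leq_mul (leqnn n) body_le) _; rewrite /n.
    case: ifP hS => m2; rewrite ?orbT ?orbF => hS.
      rewrite -mulnA; apply: leq_mul; first exact: leq_addr.
      rewrite leq_mul2l; apply/orP; right; rewrite /unit_cost leq_mul2r.
      by apply/orP; right; rewrite leq_pexp2l //; lia.
    rewrite mulnCA -[(_ * c * _)%N]mulnA -[X in (X <= _)%N]mul1n.
    apply: leq_mul; first by rewrite addn1.
    by rewrite leq_mul2l hS orbT.
  have e3 : (fc <= fc * unit_cost N m.+1)%N by rewrite leq_pmulr // (leq_trans
    _ hX).
  have e4 : (c6 <= c6 * unit_cost N m.+1)%N by rewrite leq_pmulr // (leq_trans
    _ hX).
  by rewrite !mulnDl in loop_le e3 e4 *; lia.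
Qed.
End Solving.

(** * Building the difference vectors and assembling the program *)

Definition collect : cmd :=
  For 3 (IVar 0)
    (If (BRLe (RLit 1) (RGet 1 (IVar 3)))
      (Seq (IPut 1 (IVar 2) (IVar 3)) (incr 2))
      (Seq (IPut 0 (IVar 14) (IVar 3)) (incr 14))).

Fixpoint put_axes (d n : nat) : cmd :=
  if n is n'.+1 then
    Seq (put_axes d n')
      (Seq (vput d axes (ILit n') (VAxis false n'))
        (vput d axes (ILit (d + n')) (VAxis true n')))
  else Skip.

Definition put_diffs (d : nat) : cmd :=
  For 3 (IVar 2) (For 4 (IVar 14)
    (Seq (vput d diffs (IVar iN)
       (VSub (VRow 0 (IGet 1 (IVar 3))) (VRow 0 (IGet 0 (IVar 4)))))
    (incr iN))).

Definition auc_program (d : nat) : cmd :=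
  Seq collect (Seq (put_axes d d) (Seq (put_diffs d)
    (Seq (solve d d [::]) (vput d 2 (ILit 0) (vrow (bst d)))))).

Lemma loopfree_put_axes d n : loopfree (put_axes d n).
Proof. by elim: n => //= n ->; rewrite !loopfree_vput. Qed.

Lemma sets_ivar_put_axes d n a : sets_ivar (put_axes d n) a = false.
Proof. by elim: n => //= n ->; rewrite !sets_vput. Qed.

Lemma sets_iarr_put_axes d n a : sets_iarr (put_axes d n) a = false.
Proof. by elim: n => //= n ->; rewrite !sets_vput. Qed.

Lemma sets_rarr_put_axes d n a : sets_rarr (put_axes d n) a -> a == axes.
Proof.
by elim: n => //= n IH; rewrite !sets_vput => /or3P[/IH|/andP[]|/andP[]].
Qed.

Section Preparation.
Variables (R : realType) (d : nat).
Implicit Types s : state R.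

Lemma sem_put_axes s n c : (n <= d)%N -> (c < n)%N || (d <= c < d + n)%N ->
  vec d (rarr (sem (put_axes d n) s)) axes c = axis_dir R d c.
Proof.
elim: n => [|n IH] nd /= hc; first by lia.
rewrite !vec_vput !veval_axis /= /axis_dir.
have [->|c1] := eqVneq c (d + n)%N; first by rewrite ltnNge leq_addr addKn.
have [->|c2] := eqVneq c n; first by rewrite nd.
by apply: IH; lia.
Qed.

Lemma collect_run : exists K, forall n s, ivar s 0 = n -> ivar s 2 = 0%N ->
  ivar s 14 = 0%N ->
  let pos := [seq k <- iota 0 n | 1 <= rarr s 1 k] in
  let neg := [seq k <- iota 0 n | ~~ (1 <= rarr s 1 k)] in
  run collect s (K * n.+1) (fun s' =>
    [/\ ivar s' 2 = size pos, ivar s' 14 = size neg,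
        forall l, (l < size pos)%N -> iarr s' 1 l = nth 0%N pos l &
        forall l, (l < size neg)%N -> iarr s' 0 l = nth 0%N neg l]).
Proof.
eexists => n s sn s2 s14 pos neg.
apply: (run_for (n := n) (I := fun j s' =>
  let pos := [seq k <- iota 0 j | 1 <= rarr s 1 k] in
  let neg := [seq k <- iota 0 j | ~~ (1 <= rarr s 1 k)] in
    [/\ ivar s' 2 = size pos, ivar s' 14 = size neg,
        forall l, (l < size pos)%N -> iarr s' 1 l = nth 0%N pos l &
        forall l, (l < size neg)%N -> iarr s' 0 l = nth 0%N neg l])).
- by [].
- by move=> s' k2 /=; rewrite (keeps_ivar k2).
- by [].
- move=> j s' k2 jn kj [h2 h14 h1 h0].
  apply: run_sem; [done|exact: leqnn|move=> _ _].
  rewrite [sem _ _]/= kj (keeps_rarr k2 (a := 1%N)) //.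
  have -> : iota 0 j.+1 = iota 0 j ++ [:: j] by rewrite -addn1 iotaD.
  rewrite !filter_cat /=.
  case: ifP => yj; rewrite /= ?cats0 !cats1 size_rcons /upd2 /upd /= ?h2 ?h14
    ?addn1.
  + split => // l; rewrite ltnS nth_rcons => ll.
    by have [->|ne] := eqVneq l _; rewrite ?ltnn ?eqxx // h1 ?ltn_neqAle ?ne
      ?ll.
  + split => // l; rewrite ltnS nth_rcons => ll.
    by have [->|ne] := eqVneq l _; rewrite ?ltnn ?eqxx // h0 ?ltn_neqAle ?ne
      ?ll.
- by [].
- exact: (cost_linear _ _ _ 0).
Qed.

Lemma cost_nested m n a b c : (0 < n)%N ->
  (m * (n * a + b + c) + c <= (a + b + c + c) * (m * n).+1)%N.
Proof.
move=> n0; have mn : (m <= m * n)%N by rewrite leq_pmulr.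
have : (m * (b + c) <= m * n * (b + c))%N by rewrite leq_mul2r mn orbT.
rewrite mulnS -addnA mulnDr mulnA; move: (m * n)%N => p; nia.
Qed.

Lemma put_diffs_run : exists K, forall np nn s, ivar s iN = 0%N ->
  ivar s 2 = np -> ivar s 14 = nn -> (0 < nn)%N ->
  run (put_diffs d) s (K * (np * nn).+1) (fun s' => ivar s' iN = (np * nn)%N /\
    forall k, (k < np * nn)%N -> vec d (rarr s') diffs k =
      vec d (rarr s) 0 (iarr s 1 (k %/ nn)) - vec d (rarr s) 0 (iarr s 0 (k %%
        nn))).
Proof.
eexists => np nn s s1 snp snn nn0.
pose Z k := vec d (rarr s) 0 (iarr s 1 (k %/ nn)) -
  vec d (rarr s) 0 (iarr s 0 (k %% nn)).
pose filled m s' := ivar s' iN = m /\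
  forall k, (k < m)%N -> vec d (rarr s') diffs k = Z k.
apply: (run_for (n := np) (I := fun i s' => filled (i * nn)%N s')).
- by rewrite /= !sets_vput.
- by move=> s' k2 /=; rewrite (keeps_ivar k2) //= !sets_vput.
- by rewrite mul0n; split.
- move=> i s' k2 inp ki [f1 f2].
  have inv_rarr : rarr s' 0 = rarr s 0.
    by rewrite (keeps_rarr k2) //= !sets_vput andbF.
  have inv_iarr a : iarr s' a = iarr s a.
    by rewrite (keeps_iarr k2) //= !sets_vput.
  apply: (run_for (n := nn) (I := fun j s2 => filled (i * nn + j)%N s2)).
  + by rewrite /= !sets_vput.
  + move=> s2 k3 /=; rewrite (keeps_ivar k3) /= ?sets_vput //.
    by rewrite (keeps_ivar k2) /= ?sets_vput.
  + by rewrite addn0; split.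
  + move=> j s2 k3 jnn kj [g1 g2].
    apply: run_sem; [by rewrite /= loopfree_vput|exact: leqnn|move=> _ _].
    have ki2 : ivar s2 3 = i by rewrite (keeps_ivar k3) ?ki //= !sets_vput.
    have r2 : rarr s2 0 = rarr s' 0.
      by rewrite (keeps_rarr k3) //= !sets_vput andbF.
    have i2 a : iarr s2 a = iarr s' a by rewrite (keeps_iarr k3) //= !sets_vput.
    rewrite /filled /= /upd /= !ivar_vput g1 addn1 addnS; split => // k.
    rewrite ltnS vec_vput !vevalE /= g1 !i2 !inv_iarr ki2 kj.
    have [-> _|ne le] := eqVneq k (i * nn + j)%N; last first.
      by apply: g2; rewrite ltn_neqAle ne.
    rewrite /Z divnMDl // divn_small // addn0 modnMDl modn_small //.
    by rewrite /vec r2 inv_rarr.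
  + by move=> s2 k3 [g1 g2] _; rewrite /filled mulSn addnC.
  exact: leqnn.
- by move=> s' _.
- exact: cost_nested.
Qed.

Lemma auc_program_run : exists K, forall n s, ivar s = upd (fun=> 0%N) 0%N n ->
  let pos := [seq k <- iota 0 n | 1 <= rarr s 1 k] in
  let neg := [seq k <- iota 0 n | ~~ (1 <= rarr s 1 k)] in
  let N := (size pos * size neg)%N in
  let Z k := vec d (rarr s) 0 (nth 0%N pos (k %/ size neg)) -
    vec d (rarr s) 0 (nth 0%N neg (k %% size neg)) in
  (0 < size pos)%N -> (0 < size neg)%N ->
  run (auc_program d) s (K * unit_cost N d) (fun s' =>
    exists2 W, level_best N Z d [::] W & output d s' = W).
Proof.
have [K1 h1] := collect_run; have [K3 h3] := put_diffs_run.
have [//|K4 h4] := @solve_run R d d [::].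
pose c2 := cmd_cost (put_axes d d).
pose c5 := cmd_cost (vput d 2 (ILit 0) (vrow (bst d))).
exists (2 * K1 + c2 + K3 + K4 + c5)%N => n s sI pos neg N Z pos0 neg0.
(* Both classes are nonempty, so reading the input, linear in [n], is paid for by [N]. *)
have n_le : (n <= 2 * N)%N.
  have : (size pos + size neg)%N = n.
    rewrite /pos /neg !size_filter -[RHS](size_iota 0 n).
    exact: count_predC.
  by rewrite /N; nia.
apply: run_seq (h1 n s _ _ _) _ _; [by rewrite sI..| |].
  move=> s1 k1 [i2 i14 a1 a0].
  apply: (run_seq (T1 := c2) (Q1 := fun s' => forall c, (c < d + d)%N ->
    vec d (rarr s') axes c = axis_dir R d c)) _ _ (leqnn _).
    apply: run_sem; [exact: loopfree_put_axes|exact: leqnn|move=> _ c cd].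
    by apply: sem_put_axes => //; lia.
  move=> s2 k2 ax.
  have iE a : ivar s2 a = ivar s1 a by rewrite (keeps_ivar k2) //
    sets_ivar_put_axes.
  have fr a : a != axes -> ~~ sets_rarr (put_axes d d) a.
    by apply: contraNN; apply: sets_rarr_put_axes.
  apply: run_seq (h3 (size pos) (size neg) s2 _ _ _ neg0) _ (leqnn _).
  - by rewrite iE (keeps_ivar k1) // sI.
  - by rewrite iE.
  - by rewrite iE.
  move=> s3 k3 [i1 df].
  have cs3 : ctx N Z s3.
    split => // [k kN|c cd]; last first.
      by rewrite (vec_keeps _ _ k3) ?ax //= sets_vput andbF.
    rewrite df //.
    have rE i : vec d (rarr s2) 0 i = vec d (rarr s) 0 i.
      by rewrite (vec_keeps _ _ k2) ?fr // (vec_keeps _ _ k1).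
    have aE a : iarr s2 a = iarr s1 a by rewrite (keeps_iarr k2) //
      sets_iarr_put_axes.
    by rewrite !rE !aE a1 ?a0 ?ltn_mod // ltn_divLR.
  apply: run_seq (h4 N Z s3 cs3) _ (leqnn _) => s4 k4 lb.
  apply: run_sem; [exact: loopfree_vput|exact: leqnn|move=> _].
  exists (vec d (rarr s4) (bst d) 0) => //.
  rewrite -[vec _ _ (bst d) _](veval_row d s4 (bst d) (ILit 0)).
  have := vec_vput d s4 2 (ILit 0) (vrow (bst d)) 2 0; rewrite !eqxx /= => <-.
  by apply/colP => c; rewrite !mxE.
have := unit_cost_ge N d; move: (unit_cost N d) => Y hY.
have e1 : (K1 * n.+1 <= 2 * K1 * Y)%N.
  by rewrite [(2 * K1)%N]mulnC -mulnA leq_mul2l; apply/orP; right; lia.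
have e2 : (c2 <= c2 * Y)%N by rewrite leq_pmulr // (leq_trans _ hY).
have e3 : (K3 * N.+1 <= K3 * Y)%N by rewrite leq_mul2l hY orbT.
have e5 : (c5 <= c5 * Y)%N by rewrite leq_pmulr // (leq_trans _ hY).
by rewrite !mulnDl -/N -/c5; lia.
Qed.
End Preparation.

(** * From the cost unit to the asymptotic bound *)

Lemma unit_cost_bound (R : realType) (d : nat) : (2 <= d)%N ->
  exists C : R, forall N, (2 <= N)%N ->
    (unit_cost N d)%:R <= C * (N%:R ^+ (d - 1) * ln N%:R).
Proof.
move=> d2; have ln2 : 0 < ln 2%:R :> R by rewrite ln_gt0 // ltr1n.
exists (2%:R ^+ (d - 1) * (3%:R / ln 2%:R)) => N N2.
have lnN : ln 2%:R <= ln N%:R :> R.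
  by rewrite ler_ln ?posrE ?ltr0n ?ler_nat //; lia.
(* Write [up_log 2 N = L + 1] with [2 ^ L < N]. Then [L] and each of the two remaining units are at
   most [ln N / ln 2], whence the 3. The power of 2 in the constant comes from [N + 1 <= 2 N]. *)
have L_le : (up_log 2 N).+1%:R <= 3%:R / ln 2%:R * ln N%:R :> R.
  have := up_log_gtn (isT : (1 < 2)%N) N2.
  have : (0 < up_log 2 N)%N by rewrite up_log_gt0.
  case: (up_log 2 N) => // L _ /= lt.
  have : L%:R * ln 2%:R <= ln N%:R :> R.
    rewrite mulr_natl -lnXn ?ltr0n // ler_ln ?posrE ?exprn_gt0 ?ltr0n //;
      last by lia.
    by rewrite -natrX ler_nat ltnW.
  rewrite mulrAC ler_pdivlMr // -[L.+2%:R]natr1 -[L.+1%:R]natr1 !mulrDl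
    !mul1r; lra.
rewrite /unit_cost natrM natrX -subSn // subSS.
rewrite [X in _ <= X](_ : _ = 2%:R ^+ (d - 1) * N%:R ^+ (d - 1) *
  (3%:R / ln 2%:R * ln N%:R)); last by rewrite -!mulrA; congr (_ * _); ring.
rewrite ler_pM //; first by rewrite exprn_ge0.
have N1 : N.+1%:R <= 2%:R * N%:R :> R by rewrite -natrM ler_nat; lia.
by rewrite -exprMn lerXn2r ?nnegrE ?mulr_ge0 ?ler0n.
Qed.

(** * Back to the dataset *)

Lemma big_ord_mul_divmod (m n : nat) (F : nat -> nat -> nat) : (0 < n)%N ->
  (\sum_(k < m * n) F (k %/ n) (k %% n) =
   \sum_(0 <= a < m) \sum_(0 <= b < n) F a b)%N.
Proof.
move=> n0; rewrite -(big_mkord xpredT (fun k => F (k %/ n) (k %% n))%N).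
rewrite big_nat_mul; apply: eq_bigr => a _.
rewrite -{1}[(a * n)%N]add0n big_addn mulSn addnK.
apply: eq_big_nat => b /andP[_ bn].
by rewrite addnC divnMDl // divn_small // addn0 modnMDl modn_small.
Qed.

Section Dataset.
Variables (R : realType) (d n : nat) (x : 'I_n -> 'cV[R]_d) (y : 'I_n -> R).
Hypothesis label : forall i, y i = 1 \/ y i = -1.

Let s := input x y.
Let pos := [seq k <- iota 0 n | 1 <= rarr s 1 k].
Let neg := [seq k <- iota 0 n | ~~ (1 <= rarr s 1 k)].

Lemma input_row (i : 'I_n) : vec d (rarr s) 0 i = x i.
Proof. by apply/colP => k; rewrite mxE input_point. Qed.

Lemma pos_label (i : 'I_n) : (1 <= rarr s 1 i) = (y i == 1).
Proof.
rewrite input_label; case: (label i) => ->; first by rewrite lexx eqxx.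
by rewrite (negbTE (_ : ~~ (1 <= -1 :> R))) ?lt_eqF // -?ltNge; lra.
Qed.

Lemma neg_label (i : 'I_n) : ~~ (1 <= rarr s 1 i) = (y i == -1).
Proof.
rewrite pos_label; case: (label i) => ->; rewrite ?eqxx /=.
  by rewrite gt_eqF //; lra.
by rewrite lt_eqF //; lra.
Qed.

Lemma sum_pos (F : nat -> nat) :
  (\sum_(0 <= a < size pos) F (nth 0 pos a) = \sum_(i < n | y i == 1%R) F i)%N.
Proof.
rewrite -(big_nth 0%N xpredT) big_filter.
have -> : iota 0 n = index_iota 0 n by rewrite /index_iota subn0.
by rewrite big_mkord; apply: eq_bigl => i; rewrite pos_label.
Qed.

Lemma sum_neg (F : nat -> nat) :
  (\sum_(0 <= a < size neg) F (nth 0 neg a) = \sum_(i < n | y i == (-1)%R) F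
    i)%N.
Proof.
rewrite -(big_nth 0%N xpredT) big_filter.
have -> : iota 0 n = index_iota 0 n by rewrite /index_iota subn0.
by rewrite big_mkord; apply: eq_bigl => i; rewrite neg_label.
Qed.

Lemma size_pos : size pos = npos y.
Proof.
rewrite /npos cardsE -sum1_card -(sum_pos (fun=> 1%N)).
by rewrite sum_nat_const_nat subn0 muln1.
Qed.

Lemma size_neg : size neg = nneg y.
Proof.
rewrite /nneg cardsE -sum1_card -(sum_neg (fun=> 1%N)).
by rewrite sum_nat_const_nat subn0 muln1.
Qed.

(** Division with remainder by [size neg] identifies the flat index of a difference vector with a
    pair of samples. *)
Lemma AUC_wins w : (0 < nneg y)%N ->
  AUC x y w = (wins (size pos * size neg) (fun k =>
    vec d (rarr s) 0 (nth 0%N pos (k %/ size neg)) -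
    vec d (rarr s) 0 (nth 0%N neg (k %% size neg))) w)%:R /
    (npos y * nneg y)%:R.
Proof.
move=> n0; rewrite /AUC.
under eq_bigr do rewrite -mulr_suml.
rewrite -mulr_suml; congr (_ / _).
pose G i j : nat := (0 < dot w (vec d (rarr s) 0 i - vec d (rarr s) 0 j))%R.
rewrite /wins size_neg; rewrite (big_ord_mul_divmod _
  (fun a b => G (nth 0%N pos a) (nth 0%N neg b))) // -size_neg.
under eq_bigr => a _ do rewrite (sum_neg (G (nth 0%N pos a))).
rewrite (sum_pos (fun i => \sum_(j < n | y j == (-1)%R) G i j)%N) natr_sum.
apply: eq_bigr => i _; rewrite natr_sum; apply: eq_bigr => j _.
by rewrite /G !input_row dotDr dotNr subr_gt0.
Qed.
End Dataset.

Theorem theorem3 (R : realType) (d : nat) (hd : (2 <= d)%N) :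
  exists (p : cmd) (C : R) (N0 : nat),
    forall (n : nat) (x : 'I_n -> 'cV[R]_d) (y : 'I_n -> R),
      (forall i, y i = 1 \/ y i = -1) ->
      (1 <= npos y)%N ->
      (1 <= nneg y)%N ->
      ~ linearly_separable x y ->
      exists (t : nat) (s : state R),
        [/\ exec p (input x y) t s,
            is_argmax (AUC x y) (output d s)
          & let N := (npos y * nneg y)%N in
            (N0 <= N)%N -> t%:R <= C * (N%:R ^+ (d - 1) * ln N%:R)].
Proof.
have [K hK] := auc_program_run R d; have [C hC] := @unit_cost_bound R d hd.
(* The threshold is 2 because the logarithm, and with it the bound, vanishes at [N = 1]. *)
exists (auc_program d), (K%:R * C), 2%N => n x y label np nn _.
have := hK n (input x y) erefl; cbv zeta;
  rewrite (size_pos x label) (size_neg x label).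
move=> /(_ np nn)[t [s [e le [W lb oW]]]]; exists t, s; split => //.
  move=> v; rewrite !AUC_wins // ler_wpM2r ?invr_ge0 // ler_nat.
  rewrite (size_pos x label) (size_neg x label) oW.
  exact: (level_best_max hd _ _ lb).
move=> N2; set N := (npos y * nneg y)%N in le N2 *.
apply: (@le_trans _ _ (K%:R * (unit_cost N d)%:R)).
  by rewrite -natrM ler_nat.
by rewrite -mulrA ler_wpM2l // hC.
Qed.
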